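(* Let $n\ge 2$, let $\delta \in \left(0, \frac12\right]$ and let $K\subset\mathbb{R}^n$ be a convex body such that either the convex floating body $K_\delta$ is $C^1$, or $K_\delta = K_{[\delta]}$ reduces to a point. Then $K$ is an Ulam floating body (with respect to the parameter $\delta$) if and only if there exists $R>0$ such that for all $u \in S^{n-1}$ and all $v \in S^{n-1} \cap u^\perp$, $$\int_{K\cap H_{\delta, u}} \Big(\langle x, v \rangle^2 - \langle g(K \cap H_{\delta, u}), v \rangle^2\Big) \,dx = \delta \, \mathrm{vol}_n(K)\, R .$$ In that case, $M_\delta(K)$ is a Euclidean ball of radius $R$.
   Context: A convex body in $\mathbb{R}^n$ is a compact convex set with nonempty interior; $\mathrm{vol}_n$ is Lebesgue measure, $S^{n-1}$ is the Euclidean unit sphere, and $u^\perp$ is the hyperplane through the origin orthogonal to $u$. For $\delta\in(0,\frac12]$ and $u\in S^{n-1}$, let $H_{\delta,u}=\{x:\langle x,u\rangle = t\}$ be the hyperplane orthogonal to $u$ such that, with $H^+_{\delta,u}=\{x:\langle x,u\rangle\ge t\}$ and $H^-_{\delta,u}=\{x:\langle x,u\rangle\le t\}$, one has $\mathrm{vol}_n(K\cap H^+_{\delta,u})=\delta\,\mathrm{vol}_n(K)$. The convex floating body of $K$ is $K_\delta=\bigcap_{u\in S^{n-1}}H^-_{\delta,u}$. ''$K_\delta$ is $C^1$'' means that $K_\delta$ has nonempty interior and its boundary is $C^1$ (equivalently, there is a unique supporting hyperplane at every boundary point). Dupin's floating body $K_{[\delta]}$, if it exists, is the convex body (here a single point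 is also allowed) contained in $K$ such that every supporting hyperplane of it cuts off from $K$ a set of volume exactly $\delta\,\mathrm{vol}_n(K)$ (for a single point, the supporting hyperplanes are all hyperplanes through the point). For a set $B$ contained in a hyperplane, $g(B)$ denotes its centroid with respect to $(n-1)$-dimensional Lebesgue measure in that hyperplane, and the integral over $K\cap H_{\delta,u}$ is with respect to $(n-1)$-dimensional Lebesgue measure. The metronoid $M_\delta(K)$ is the convex body whose boundary is $\partial M_\delta(K)=\{X_{K,\delta}(u):u\in S^{n-1}\}$, where $X_{K,\delta}(u)=\frac{1}{\delta\,\mathrm{vol}_n(K)}\int_{K\cap H^+_{\delta,u}}x\,dx$. (It is known that $M_\delta(K)$ is a strictly convex body with $C^1$ boundary, and that the outer unit normal of $M_\delta(K)$ at $X_{K,\delta}(u)$ is $u$.) Ulam floating body: a body of uniform density (relative density $\rho=1-\delta$ in a liquid of density $1$, so that the floating part cut off above the surface has volume $\delta\,\mathrm{vol}_n(K)$) which floats in the liquid in equilibrium in every direction. The formal meaning, via the characterization of Huang, Slomka and Werner used in the paper, is: $K$ is an Ulam floating body (with respect to $\delta$) if and only if $M_\delta(K)$ is a Euclidean ball. *)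

(* Defs.v *)
From HB Require Import structures.
From mathcomp Require Import all_boot all_order all_algebra.
From mathcomp Require Import all_classical all_reals all_analysis.
From mathcomp Require Import measurable_realfun ring.

Set Implicit Arguments.
Unset Strict Implicit.
Unset Printing Implicit Defensive.

Import Order.TTheory GRing.Theory Num.Theory.
Import numFieldNormedType.Exports.

Local Open Scope classical_set_scope.
Local Open Scope ring_scope.

(* 'rV[T]_n carries the product sigma-algebra, as n.-tuple T does in the
   library; for T a realType it is the Borel sigma-algebra of R^n. *)
Section measurable_rowvec.
Context {d : measure_display} {T : measurableType d} (n : nat).

Let coors : 'I_n -> 'rV[T]_n -> T := fun i x => x 0 i.

Let rV_set0 : g_sigma_preimage coors set0.
Proof. exact: sigma_algebra0. Qed.

Let rV_setC A : g_sigma_preimage coors A -> g_sigma_preimage coors (~` A).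
Proof. exact: sigma_algebraC. Qed.

Let rV_bigcup (F : (set 'rV[T]_n)^nat) :
  (forall i, g_sigma_preimage coors (F i)) ->
  g_sigma_preimage coors (\bigcup_i (F i)).
Proof. exact: sigma_algebra_bigcup. Qed.

HB.instance Definition _ := @isMeasurable.Build (measure_tuple_display d)
  'rV[T]_n (g_sigma_preimage coors) rV_set0 rV_setC rV_bigcup.

End measurable_rowvec.

Section measurable_fun_rowvec.
Context {R : realType} (n : nat).

Lemma measurable_coord (i : 'I_n) :
  measurable_fun [set: 'rV[R]_n] (fun x : 'rV[R]_n => x 0 i).
Proof.
move=> _ Y mY; rewrite setTI; apply: sub_sigma_algebra => /=.
rewrite -bigcup_seq/=; exists i => /=; first by rewrite mem_index_enum.
by exists Y => //; rewrite setTI.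
Qed.

Lemma measurable_fun_rV d (T : measurableType d) (f : T -> 'rV[R]_n) :
  (forall i, measurable_fun [set: T] (fun x => f x 0 i)) ->
  measurable_fun [set: T] f.
Proof.
move=> mf.
have H : preimage_set_system setT f (measurable : set (set 'rV[R]_n))
    `<=` measurable.
  rewrite /measurable/= /g_sigma_preimage -g_sigma_preimageE.
  apply: smallest_sub; first exact: sigma_algebra_measurable.
  move=> _ [B + <-]; rewrite -bigcup_seq => -[i _ [A mA <-]].
  have := mf i measurableT A mA.
  by rewrite !setTI -comp_preimage.
by move=> _ Y mY; apply: H; exists Y.
Qed.

End measurable_fun_rowvec.

Section lebesgueS.
Context {R : realType} (n : nat).

Definition rV_cons (p : measurableTypeR R * 'rV[R]_n) : 'rV[R]_n.+1 :=
  row_mx (p.1)%:M p.2.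

Lemma rV_cons0 p : rV_cons p 0 0 = p.1.
Proof.
rewrite mxE; case: splitP => [j _|k /= /eqP]; last by rewrite add1n.
by rewrite mxE !ord1 eqxx.
Qed.

Lemma rV_consS p (i : 'I_n) : rV_cons p 0 (lift ord0 i) = p.2 0 i.
Proof.
rewrite mxE; case: splitP => [j /= ij|k /= [] /val_inj ->//].
by have := ltn_ord j; rewrite -ij.
Qed.

Lemma measurable_rV_cons : measurable_fun setT rV_cons.
Proof.
apply: measurable_fun_rV => i; case: (unliftP ord0 i) => [j ->|->].
- rewrite (_ : (fun _ => _) = (fun x : 'rV[R]_n => x 0 j) \o snd); last first.
    by apply/funext => x /=; rewrite rV_consS.
  apply: measurableT_comp; first exact: measurable_coord.
  exact: measurable_snd.
- rewrite (_ : (fun _ => _) = fst); last by apply/funext => x; rewrite rV_cons0.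
  exact: measurable_fst.
Qed.

Variable m : {sigma_finite_measure set 'rV[R]_n -> \bar R}.

Definition lebesgueS : set 'rV[R]_n.+1 -> \bar R :=
  pushforward (lebesgue_measure \x m)%E rV_cons.

Let mu := measure_function_pushforward__canonical__measure_function_Measure
  (lebesgue_measure \x m)%E measurable_rV_cons.

HB.instance Definition _ := isMeasure.Build _ _ _ lebesgueS
  (measure0 mu) (measure_ge0 mu) (@measure_semi_sigma_additive _ _ _ mu).

Let lebesgueS_sigma_finite : sigma_finite setT lebesgueS.
Proof.
have [F TF Fm] : sigma_finite setT (lebesgue_measure \x m)%E.
  have /sigma_finiteP[F [TF ndF Foo]] := sigma_finiteT (@lebesgue_measure R).
  have /sigma_finiteP[G [TG ndG Goo]] := sigma_finiteT m.
  exists (fun k => F k `*` G k).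
    rewrite -setXTT TF TG predeqE => -[x y]; split.
      move=> [/= [i _ Fix] [j _ Gjy]]; exists (maxn i j) => //; split.
      - by move: x Fix; exact/subsetPset/ndF/leq_maxl.
      - by move: y Gjy; exact/subsetPset/ndG/leq_maxr.
    by move=> [k _ []/= ? ?]; split; exists k.
  move=> k; have [? ?] := Foo k; have [? ?] := Goo k.
  split; first exact: measurableX.
  by rewrite product_measure1E// lte_mul_pinfty// ge0_fin_numE.
pose unc (x : 'rV[R]_n.+1) : measurableTypeR R * 'rV[R]_n :=
  (x 0 0, \row_j x 0 (lift ord0 j)).
have uncK p : unc (rV_cons p) = p.
  case: p => a y; rewrite /unc rV_cons0; congr pair.
  by apply/rowP => j; rewrite mxE rV_consS.
have munc : measurable_fun setT unc.
  apply/measurable_fun_pair; first exact: measurable_coord.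
  apply: measurable_fun_rV => i; under eq_fun do rewrite mxE.
  exact: measurable_coord.
exists (fun k => unc @^-1` F k).
  by rewrite -preimage_bigcup -TF preimage_setT.
move=> k; have [mFk Fkoo] := Fm k; split.
  by rewrite -[X in measurable X]setTI; exact: munc.
rewrite /lebesgueS /pushforward -comp_preimage.
by rewrite (_ : _ \o _ = id)//; apply/funext => p /=; rewrite uncK.
Qed.

HB.instance Definition _ := Measure_isSigmaFinite.Build _ _ _ lebesgueS
  lebesgueS_sigma_finite.
End lebesgueS.

(* n-dimensional Lebesgue measure on 'rV[R]_n, one coordinate at a time; see
   lebesgue_rV_box for its value on boxes. *)
Fixpoint lebesgue_rV {R : realType} (n : nat) :
    {sigma_finite_measure set 'rV[R]_n -> \bar R} :=
  match n with
  | 0 => @dirac _ 'rV[R]_0 0 R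
  | n'.+1 => lebesgueS (lebesgue_rV n')
  end.

Lemma lebesgue_rV_box (R : realType) (n : nat)
    (A : 'I_n -> set (measurableTypeR R)) :
  (forall i, measurable (A i)) ->
  lebesgue_rV n [set x : 'rV[R]_n | forall i, A i (x 0 i)] =
  (\prod_(i < n) lebesgue_measure (A i))%E.
Proof.
elim: n A => [|n IH] A mA.
  by rewrite big_ord0 /= diracE mem_set// => -[].
have mB : measurable [set x : 'rV[R]_n | forall i, A (lift ord0 i) (x 0 i)].
  rewrite (_ : [set _ | _] = \bigcap_(i in [set: 'I_n])
      ((fun x : 'rV[R]_n => x 0 i) @^-1` A (lift ord0 i))).
    apply: fin_bigcap_measurable => // i _.
    rewrite -[X in measurable X]setTI.
    by apply: measurable_coord => //; exact: mA.
  by apply/seteqP; split => [x Ax i _|x Ax i]; exact: Ax.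
rewrite big_ord_recl -IH// -product_measure1E// /= /lebesgueS /pushforward.
congr ((_ \x _)%E _); apply/seteqP; split => [[a y] /= Ax|[a y] /= [Aa Ay] i].
- by split=> [|i]; [have := Ax 0|have := Ax (lift ord0 i)];
    rewrite ?rV_cons0 ?rV_consS.
- by case: (unliftP ord0 i) => [j ->|->]; rewrite ?rV_cons0 ?rV_consS//; exact: Ay.
Qed.

Section euclidean.
Context {R : realType} {n : nat}.
Implicit Types (u v x : 'rV[R]_n) (t r : R) (A K D M : set 'rV[R]_n).

(* The norm provided by the library on 'rV[R]_n is the sup norm, which induces
   the right topology; the Euclidean structure is spelled out here. *)
Definition dot u v : R := \sum_(i < n) u 0 i * v 0 i.

Definition enorm x : R := Num.sqrt (dot x x).

Definition unit_sphere : set 'rV[R]_n := [set u | enorm u = 1].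

Definition eball x r : set 'rV[R]_n := [set y | enorm (y - x) <= r].

Definition hyperplane u t : set 'rV[R]_n := [set x | dot x u = t].

Definition halfspace_ge u t : set 'rV[R]_n := [set x | t <= dot x u].

Definition halfspace_le u t : set 'rV[R]_n := [set x | dot x u <= t].

Definition bdry A : set 'rV[R]_n := closure A `\` A°.

Definition convex_body K := [/\ compact K, convex_set K & K° !=set0].

Definition vol A : R := fine (lebesgue_rV n A).

(* The boundary is locally a regular level set of a C^1 function. *)
Definition C1_boundary A :=
  forall p, bdry A p -> exists (U : set 'rV[R]_n) (f : 'rV[R]_n -> R),
    [/\ open U /\ U p,
        forall x, U x -> differentiable f x,
        forall v x, U x -> {for x, continuous (fun y => 'd f y v)},
        exists v, 'd f p v != 0
      & bdry A `&` U = [set x | f x = 0] `&` U].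

Definition C1_body A := A° !=set0 /\ C1_boundary A.

End euclidean.

(* (n-1)-dimensional Lebesgue measure on hyperplane u t, |u| = 1: the image of
   Lebesgue measure on R^(n-1) under the isometry y |-> t u + y B, where the
   rows of B form an orthonormal basis of the orthogonal complement of u
   (one exists by orthonormal_frame_ex, and the image measure does not depend
   on which one is chosen). *)
Section hyperplane_measure.
Context {R : realType} {n : nat}.
Implicit Types (u : 'rV[R]_n) (t : R).

Definition is_orthonormal_frame u (B : 'M[R]_(n.-1, n)) :=
  B *m B^T = 1%:M /\ B *m u^T = 0.

Definition orthonormal_frame u : 'M[R]_(n.-1, n) :=
  get (is_orthonormal_frame u).

Definition hyperplane_chart u t (y : 'rV[R]_n.-1) : 'rV[R]_n :=
  t *: u + y *m orthonormal_frame u.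

Lemma measurable_hyperplane_chart u t :
  measurable_fun [set: 'rV[R]_n.-1] (hyperplane_chart u t).
Proof.
apply: measurable_fun_rV => i.
under eq_fun do rewrite !mxE.
apply: measurable_funD => //; apply: measurable_sum => j.
by apply: measurable_funM => //; exact: measurable_coord.
Qed.

Definition hyperplane_measure u t : set 'rV[R]_n -> \bar R :=
  pushforward (lebesgue_rV n.-1) (hyperplane_chart u t).

Let mu u t := measure_function_pushforward__canonical__measure_function_Measure
  (lebesgue_rV n.-1) (measurable_hyperplane_chart u t).

HB.instance Definition _ u t :=
  isMeasure.Build _ _ _ (hyperplane_measure u t)
    (measure0 (mu u t)) (measure_ge0 (mu u t))
    (@measure_semi_sigma_additive _ _ _ (mu u t)).

End hyperplane_measure.

Lemma orthonormal_frame_ex (R : realType) (n : nat) (u : 'rV[R]_n) :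
  unit_sphere u -> exists B, is_orthonormal_frame u B.
Proof.
rewrite /unit_sphere/= /enorm => u1.
have {u1} : dot u u = 1.
  apply/eqP; rewrite -(eqr_sqrt _ ler01) ?sqrtr1 ?u1//.
  by apply: sumr_ge0 => i _; rewrite -expr2 sqr_ge0.
rewrite /is_orthonormal_frame /dot.
case: n u => [|m] u; first by rewrite big_ord0 => /eqP; rewrite eq_sym oner_eq0.
move=> uu.
suff [Q QQ Qu] : exists2 Q : 'M[R]_m.+1, Q *m Q^T = 1%:M & row 0 Q = u.
  have QQE a b : \sum_j Q a j * Q b j = (a == b)%:R.
    move: QQ => /matrixP/(_ a b); rewrite !mxE => <-.
    by apply: eq_bigr => j _; rewrite mxE.
  exists (row' 0 Q); split; apply/matrixP => i j; rewrite !mxE.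
    under eq_bigr do rewrite !mxE.
    by rewrite QQE (inj_eq lift_inj).
  rewrite -[RHS](_ : (lift 0 i == 0 :> 'I_m.+1)%:R = 0).
    by rewrite -QQE; apply: eq_bigr => k _; rewrite -Qu !mxE.
  by rewrite eq_sym (negbTE (neq_lift 0 i)).
pose e : 'rV[R]_m.+1 := delta_mx 0 0.
pose w := u - e.
have uuT : u *m u^T = 1%:M.
  apply/matrixP => i j; rewrite !ord1 !mxE /=; under eq_bigr do rewrite mxE.
  exact: uu.
have ewE (x : 'rV[R]_m.+1) : e *m x^T = (x 0 0)%:M.
  apply/matrixP => i j; rewrite !ord1 -rowE !mxE.
  by rewrite eqxx mulr1n.
have wwE : w *m w^T = (2 * (1 - u 0 0))%:M.
  have ueE : u *m e^T = (u 0 0)%:M.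
    by rewrite -[LHS]trmxK trmx_mul trmxK ewE tr_scalar_mx.
  rewrite /w linearB/= mulmxBl !mulmxBr uuT ueE !ewE mxE !eqxx/=.
  by rewrite -!raddfB/=; congr (_%:M); ring.
have [u00|u00] := eqVneq (u 0 0) 1.
  exists 1%:M; first by rewrite trmx1 mulmx1.
  move: wwE; rewrite u00 subrr mulr0 => /matrixP/(_ 0 0).
  rewrite !mxE eqxx mulr1n; under eq_bigr do rewrite [_^T _ _]mxE -expr2.
  move=> /eqP; rewrite psumr_eq0 => [/allP w0|i _]; last by rewrite sqr_ge0.
  apply/rowP => i; have := w0 i (mem_index_enum _).
  rewrite sqrf_eq0 !mxE !eqxx/= subr_eq0 => /eqP ->.
  by rewrite [in LHS]eq_sym.
have c0 : 1 - u 0 0 != 0 by rewrite subr_eq0 eq_sym.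
pose c := (1 - u 0 0)^-1.
have PP : (w^T *m w) *m (w^T *m w) = (2 * (1 - u 0 0)) *: (w^T *m w).
  by rewrite mulmxA -(mulmxA w^T) wwE mul_mx_scalar -scalemxAl.
have PT : (w^T *m w)^T = w^T *m w by rewrite trmx_mul trmxK.
exists (1%:M - c *: (w^T *m w)).
  move: (w^T *m w) PP PT => P PP PT.
  have -> : (1%:M - c *: P)^T = 1%:M - c *: P.
    by rewrite linearB/= linearZ/= trmx1 PT.
  rewrite mulmxBl !mulmxBr !mul1mx mulmx1.
  rewrite -!scalemxAl -!scalemxAr PP !scalerA.
  rewrite (_ : c * c * (2 * (1 - u 0 0)) = c + c); last by rewrite /c; field.
  by rewrite scalerDl opprB !addrA addrK subrK.
rewrite rowE mulmxBr mulmx1 -scalemxAr mulmxA ewE mul_scalar_mx scalerA.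
rewrite (_ : c * w 0 0 = -1); last by rewrite /c !mxE !eqxx/=; field.
by rewrite scaleN1r opprK /w addrC subrK.
Qed.

Section floating_bodies.
Context {R : realType} {n : nat}.
Implicit Types (u v : 'rV[R]_n) (t delta r : R) (K D M : set 'rV[R]_n).

(* The t with H_{delta,u} = hyperplane u t; for a convex body K and
   0 < delta < 1 it exists and is unique. *)
Definition cut_level K delta u : R :=
  get [set t | vol (K `&` halfspace_ge u t) = delta * vol K].

Definition cut_hyperplane K delta u := hyperplane u (cut_level K delta u).

Definition floating_body K delta : set 'rV[R]_n :=
  \bigcap_(u in unit_sphere) halfspace_le u (cut_level K delta u).

Definition supports D u t :=
  D `<=` halfspace_le u t /\ D `&` hyperplane u t !=set0.

Definition is_dupin_floating_body K delta D :=
  [/\ convex_body D \/ exists p, D = [set p],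
      D `<=` K
    & forall u t, unit_sphere u -> supports D u t ->
        vol (K `&` halfspace_ge u t) = delta * vol K].

Definition cap_centroid K delta u : 'rV[R]_n :=
  \row_i ((delta * vol K)^-1 *
    \int[lebesgue_rV n]_(x in
      K `&` halfspace_ge u (cut_level K delta u)) x 0 i).

(* A convex body is determined by its boundary. *)
Definition metronoid K delta : set 'rV[R]_n :=
  get [set M | convex_body M /\ bdry M = cap_centroid K delta @` unit_sphere].

Definition ulam_floating_body K delta :=
  exists c r, 0 < r /\ metronoid K delta = eball c r.

Definition hyperplane_centroid u t (B : set 'rV[R]_n) : 'rV[R]_n :=
  \row_i ((fine (hyperplane_measure u t B))^-1 *
    \int[hyperplane_measure u t]_(x in B) x 0 i).

Definition section_moment K delta u v : R :=
  let t := cut_level K delta u in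
  let B := K `&` cut_hyperplane K delta u in
  \int[hyperplane_measure u t]_(x in B)
    (dot x v ^+ 2 - dot (hyperplane_centroid u t B) v ^+ 2).

End floating_bodies.

(* Main.v *)
Require Import Defs.
From mathcomp Require Import all_boot all_order all_algebra.
From mathcomp Require Import all_classical all_reals all_analysis.
From mathcomp Require Import measurable_realfun ring lra.

(* Let X(u) be the centroid of the cap cut off in the direction u, and g the
   centroid of its base K /\ H_u. If u is tilted towards v, the half-space
   through the axis {<x, v> = <g, v>} of H_u keeps the volume of the cap to
   first order, so it may replace the cutting half-space, and
     <dX(u) v, e> = (delta vol K)^-1 * int_(K /\ H_u) (<x, v> - <g, v>) <x, e> dx,
   a symmetric bilinear form in (v, e) which vanishes for e = u and whose
   diagonal is the section moment over delta vol K. By polarization the section moments are all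
   equal to delta vol K r iff X - r u has zero derivative on the sphere, that
   is, iff X(u) = c + r u for a fixed c. Since X(u) maximizes <X(w), u> over w,
   the latter says exactly that the X(u) form the sphere of center c and
   radius r. *)

Set Implicit Arguments.
Unset Strict Implicit.
Unset Printing Implicit Defensive.

Import Order.TTheory GRing.Theory Num.Theory.
Import numFieldNormedType.Exports.

Local Open Scope classical_set_scope.
Local Open Scope ring_scope.

(** * Lebesgue measure and linear maps *)

(** No regularity in [u] of the cutting level is available beforehand, so the level is never
    differentiated. The exact half-space and the one through the centroid of the section have the
    same normal, so the difference of their indicators has constant sign, and the error made on an
    integrand bounded on [K] is controlled by the volume error alone. The first-order term comes
    from blowing up the normal direction by [1 / e]: the wedge between two half-spaces becomes
    independent of [e], and dominated convergence applies once the integrand is continuous almost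
    everywhere on the limit hyperplane. Convexity provides this, since the boundary of [K] is
    negligible on a section through the interior. The blow-up needs coordinates adapted to an
    arbitrary [u], whereas the measure is built one coordinate at a time; its rotation invariance is
    therefore derived, by an argument of Haar type. Great circles are parametrized by the tangent of
    the half angle, which keeps all identities between rotations rational. *)

Section rowvec_measurability.
Context {R : realType}.

Lemma measurable_rV_setX {n : nat} (A : 'I_n -> set (measurableTypeR R)) :
  (forall i, measurable (A i)) ->
  measurable [set x : 'rV[R]_n | forall i, A i (x 0 i)].
Proof.
move=> mA; rewrite (_ : [set _ | _] = \bigcap_(i in [set: 'I_n])
    ((fun x : 'rV[R]_n => x 0 i) @^-1` A i)).
  apply: fin_bigcap_measurable => // i _.
  by rewrite -[X in measurable X]setTI; apply: measurable_coord => //; exact: mA.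
by apply/seteqP; split => [x Ax i _|x Ax i]; exact: Ax.
Qed.

Lemma nbhs_rVP {n : nat} (x : 'rV[R]_n) (U : set 'rV[R]_n) :
  nbhs x U <-> exists2 e : R, 0 < e &
    forall y : 'rV[R]_n, (forall i, `|x 0 i - y 0 i| < e) -> U y.
Proof.
rewrite nbhs_ballP; split => -[e /= e0 eU]; exists e => //.
- move=> y xy; apply: eU; split => // i j; rewrite ord1; exact: xy.
- by move=> y [_ xy]; apply: eU => i; exact: (xy 0 i).
Qed.

(** The sigma-algebra is generated by the coordinates; an open set belongs to it as the countable
    union of the boxes with rational centre and radius that it contains. *)
Lemma open_measurable_rV {n : nat} (U : set 'rV[R]_n) : open U -> measurable U.
Proof.
move=> oU.
pose I : Type := ('rV[rat]_n * rat)%type.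
pose c (p : I) : 'rV[R]_n := map_mx ratr p.1.
pose box (p : I) : set 'rV[R]_n :=
  [set x | forall i, (fun i => ball (c p 0 i) (ratr p.2 : R)) i (x 0 i)].
have -> : U = \bigcup_(p in [set p : I | box p `<=` U]) box p.
  apply/seteqP; split => [x Ux|x [p /= pU]]; last exact: pU.
  have /nbhs_rVP[e /= e0 eU] := open_nbhs_nbhs (conj oU Ux).
  have [q q0 qe] : exists2 q : rat, 0 < ratr q :> R & ratr q < e / 2.
    have [q] := rat_in_itvoo (divr_gt0 e0 (@ltr0n R 2)).
    by rewrite in_itv /= => /andP[? ?]; exists q.
  have xq i : exists r : rat, `|ratr r - x 0 i| < ratr q.
    have xx : x 0 i - ratr q < x 0 i + ratr q by lra.
    have [r] := rat_in_itvoo xx.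
    by rewrite in_itv /= => ?; exists r; rewrite ltr_norml; lra.
  have [r rP] := choice xq.
  exists (\row_i r i, q) => /=; last by move=> i; rewrite /c/= !mxE; exact: rP.
  move=> y yb; apply: eU => i; have := yb i; have := rP i.
  by rewrite /c/= !mxE /ball/= !ltr_norml; lra.
rewrite bigcup_mkcond; apply: countable_bigcupT_measurable => [|p].
  exact: (@countableP ('rV[rat]_n * rat)%type).
case: ifP => // _; apply: measurable_rV_setX => i; exact: measurable_ball.
Qed.

Lemma closed_measurable_rV {n : nat} (A : set 'rV[R]_n) : closed A -> measurable A.
Proof.
move=> cA; rewrite -[A]setCK; apply: measurableC; apply: open_measurable_rV.
by rewrite openC.
Qed.
End rowvec_measurability.

Section lebesgue_rV_reflection.
Context {R : realType}.

Lemma lebesgue_measure_reflect (a : R) (A : set R) : measurable A ->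
  pushforward lebesgue_measure (fun x : R => a - x : measurableTypeR R) A = lebesgue_measure A.
Proof.
move=> mA; apply/esym.
have mf : measurable_fun setT (fun x : R => a - x : measurableTypeR R).
  by apply: measurable_funB.
apply: lebesgue_measure_unique => //= _ [[b c]] _ <-.
rewrite /pushforward /= (_ : _ @^-1` _ = `[a - c, a - b[%classic); last first.
  by apply/seteqP; split => x /=; rewrite !in_itv/=; lra.
rewrite !lebesgue_measure_itv/= !lte_fin.
rewrite (_ : (a - c < a - b) = (b < c)); last by rewrite ltrD2l ltrN2.
by case: ifPn => // _; rewrite -!EFinD; congr (_%:E); ring.
Qed.

(** Induction on the dimension: the slices are reflected by the induction hypothesis, the outer
    integral by the one-dimensional case. Reflections are the basic invariance because two of them
    compose to a translation and [haar_uniqueness] uses one directly. *)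
Lemma lebesgue_rV_reflect (n : nat) (a : 'rV[R]_n) (A : set 'rV[R]_n) : measurable A ->
  lebesgue_rV n ((fun x => a - x) @^-1` A) = lebesgue_rV n A.
Proof.
elim: n a A => [|n IH] a A mA.
  rewrite /= /dirac /=; rewrite [X in \1_X](_ : _ = A)//.
  by apply/funext => x /=; rewrite (_ : a - x = x)//; apply/rowP; case.
have mC : measurable (@rV_cons R n @^-1` A).
  by rewrite -[X in measurable X]setTI; exact: measurable_rV_cons.
pose a' : 'rV[R]_n := \row_j a 0 (lift ord0 j).
pose h (x : measurableTypeR R) : measurableTypeR R := a 0 0 - x.
have mh : measurable_fun setT h by apply: measurable_funB.
have mF := measurable_fun_xsection (lebesgue_rV n) mC.
have E x (y : 'rV[R]_n) : a - rV_cons (x, y) = rV_cons (h x, a' - y).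
  apply/rowP => i; rewrite 2!mxE; case: (unliftP ord0 i) => [j ->|->].
    by rewrite !rV_consS !mxE.
  by rewrite !rV_cons0.
rewrite /= /lebesgueS /pushforward /= /product_measure1.
transitivity (\int[lebesgue_measure]_x
    ((lebesgue_rV n \o xsection (@rV_cons R n @^-1` A)) \o h) x)%E.
  apply: eq_integral => x _ /=.
  rewrite -[RHS](IH a'); last exact: measurable_xsection.
  congr (lebesgue_rV n _); apply/seteqP.
  by split => y; rewrite /xsection/= !inE/= E.
rewrite -[X in integral _ X _](preimage_setT h) -(ge0_integral_pushforward mh)//.
by apply: eq_measure_integral => B mB _; exact: lebesgue_measure_reflect.
Qed.

Lemma lebesgue_rV_translate (n : nat) (a : 'rV[R]_n) (A : set 'rV[R]_n) : measurable A ->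
  lebesgue_rV n ((fun x => x + a) @^-1` A) = lebesgue_rV n A.
Proof.
move=> mA; have mB : measurable ((fun x : 'rV[R]_n => a - x) @^-1` A).
  rewrite -[X in measurable X]setTI; suff: measurable_fun setT (fun x : 'rV[R]_n => a - x) by apply.
  apply: measurable_fun_rV => i; under eq_fun do rewrite !mxE.
  by apply: measurable_funB => //; exact: measurable_coord.
rewrite -(@lebesgue_rV_reflect _ a A)// -(@lebesgue_rV_reflect _ 0 _ mB).
congr (lebesgue_rV n _); apply/seteqP.
by split => x /=; rewrite sub0r opprK addrC.
Qed.
End lebesgue_rV_reflection.

(** * Lebesgue measure under an invertible matrix, up to a constant factor *)

Section haar.
Context {R : realType}.

Lemma measurable_mulmx {n p : nat} (M : 'M[R]_(n, p)) :
  measurable_fun setT (fun x : 'rV[R]_n => x *m M).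
Proof.
apply: measurable_fun_rV => i; under eq_fun do rewrite mxE.
apply: measurable_sum => j; apply: measurable_funM => //.
exact: measurable_coord.
Qed.

Lemma measurable_addv {d} {T : measurableType d} {n : nat} (f g : T -> 'rV[R]_n) :
  measurable_fun setT f -> measurable_fun setT g ->
  measurable_fun setT (fun x => f x + g x).
Proof.
move=> mf mg; apply: measurable_fun_rV => i; under eq_fun do rewrite mxE.
by apply: measurable_funD; [apply: (measurableT_comp (measurable_coord i)) mf
  |apply: (measurableT_comp (measurable_coord i)) mg].
Qed.

Lemma measurable_preim {d d'} {T : measurableType d} {U : measurableType d'} (f : T -> U)
  (A : set U) : measurable_fun setT f -> measurable A -> measurable (f @^-1` A).
Proof. by move=> mf mA; rewrite -[X in measurable X]setTI; exact: mf. Qed.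

Section haar_matrix.
Context {n : nat} (M : 'M[R]_n).
Let nu := @lebesgue_rV R n.
Let E (A B : set 'rV[R]_n) : set ('rV[R]_n * 'rV[R]_n) :=
  [set p | A (p.1 *m M) /\ B (p.2 - p.1 *m M)].

Let mE A B : measurable A -> measurable B -> measurable (E A B).
Proof.
move=> mA mB; have m1 : measurable_fun setT (fun p : 'rV[R]_n * 'rV[R]_n => p.1 *m M).
  by apply: (measurableT_comp (measurable_mulmx M)); exact: measurable_fst.
have m2 : measurable_fun setT (fun p : 'rV[R]_n * 'rV[R]_n => p.2 - p.1 *m M).
  apply: measurable_addv; first exact: measurable_snd.
  under eq_fun do rewrite -mulmxN.
  by apply: (measurableT_comp (measurable_mulmx (- M))); exact: measurable_fst.
exact: (measurableI _ _ (measurable_preim m1 mA) (measurable_preim m2 mB)).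
Qed.

(** For fixed [x] the slice is a translate of [B] when [x M] lies in [A] and empty otherwise, so
    translation invariance makes the integral a product. *)
Let intE A B : measurable A -> measurable B ->
  (\int[nu]_x nu (xsection (E A B) x) = nu ((fun x => x *m M) @^-1` A) * nu B)%E.
Proof.
move=> mA mB.
have mMA := measurable_preim (measurable_mulmx M) mA.
transitivity (\int[nu]_x (nu B * (\1_((fun x => x *m M) @^-1` A) x)%:E)%E)%E.
  apply: eq_integral => x _; have [xA|xA] := pselect (A (x *m M)).
    rewrite indicE mem_set// mule1 -(lebesgue_rV_translate (- (x *m M)) mB)//.
    congr (nu _); apply/seteqP; split => y; rewrite /xsection/E/= inE/=; first by case.
    by [].
  rewrite indicE memNset// mule0 (_ : xsection _ _ = set0) ?measure0//.
  by rewrite -subset0 => y; rewrite /xsection/E/= inE/= => -[].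
rewrite ge0_integralZl//.
  by rewrite integral_indic// setIT muleC.
exact/measurable_EFinP.
Qed.

Let tonelliE A B : measurable A -> measurable B ->
  (\int[nu]_x nu (xsection (E A B) x) = \int[nu]_y nu (ysection (E A B) y))%E.
Proof.
move=> mA mB; have := indic_fubini_tonelli nu nu (mE mA mB).
by rewrite indic_fubini_tonelli_FE ?indic_fubini_tonelli_GE; try exact: mE.
Qed.

(* Integrate the indicator of [x M \in A, y - x M \in B] over (x, y): the
   reflection x -> y M^-1 - x exchanges the roles of A and B. *)
Lemma haar_uniqueness A B : M \in unitmx -> measurable A -> measurable B ->
  (nu ((fun x => x *m M) @^-1` A) * nu B = nu ((fun x => x *m M) @^-1` B) * nu A)%E.
Proof.
move=> uM mA mB; rewrite -!intE// !tonelliE//.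
apply: eq_integral => y _.
rewrite -(lebesgue_rV_reflect (y *m invmx M)); last by apply: measurable_ysection; exact: mE.
congr (nu _); apply/seteqP; split => x; rewrite /ysection/E/= !inE/=;
  by rewrite mulmxBl mulmxKV// opprB addrCA subrr addr0 => -[? ?]; split.
Qed.

End haar_matrix.
End haar.

(** * Euclidean structure and orthonormal charts *)

Section dot_theory.
Context {R : realType} {n : nat}.
Implicit Types (x y z u v : 'rV[R]_n) (c : R).

Lemma dotE x y : dot x y = (x *m y^T) 0 0.
Proof. by rewrite mxE; apply: eq_bigr => i _; rewrite mxE. Qed.

Lemma dotC x y : dot x y = dot y x.
Proof. by apply: eq_bigr => i _; rewrite mulrC. Qed.

Lemma dotDl x y z : dot (x + y) z = dot x z + dot y z.
Proof. by rewrite !dotE mulmxDl mxE. Qed.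

Lemma dotZl c x z : dot (c *: x) z = c * dot x z.
Proof. by rewrite !dotE -scalemxAl mxE. Qed.

Lemma dotNl x z : dot (- x) z = - dot x z.
Proof. by rewrite -scaleN1r dotZl mulN1r. Qed.

Lemma dotBl x y z : dot (x - y) z = dot x z - dot y z.
Proof. by rewrite dotDl dotNl. Qed.

Lemma dotDr x y z : dot z (x + y) = dot z x + dot z y.
Proof. by rewrite dotC dotDl !(dotC z). Qed.

Lemma dotZr c x z : dot z (c *: x) = c * dot z x.
Proof. by rewrite dotC dotZl !(dotC z). Qed.

Lemma dotNr x z : dot z (- x) = - dot z x.
Proof. by rewrite dotC dotNl !(dotC z). Qed.

Lemma dotBr x y z : dot z (x - y) = dot z x - dot z y.
Proof. by rewrite dotDr dotNr. Qed.

Definition dot_linE := (dotDl, dotBl, dotZl, dotNl, dotDr, dotBr, dotZr, dotNr).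

Lemma dot0l x : dot 0 x = 0.
Proof. by rewrite -(scale0r 0) dotZl mul0r. Qed.

Lemma dot_delta x i : dot x (delta_mx 0 i) = x 0 i.
Proof.
rewrite /dot (bigD1 i)//= !mxE !eqxx mulr1 big1 ?addr0// => j ji.
by rewrite !mxE (negbTE ji) mulr0.
Qed.

Lemma dot_ge0 x : 0 <= dot x x.
Proof. by apply: sumr_ge0 => i _; rewrite -expr2 sqr_ge0. Qed.

Lemma le_sqr_coord x i : x 0 i ^+ 2 <= dot x x.
Proof.
rewrite /dot (bigD1 i)//= -expr2 lerDl.
by apply: sumr_ge0 => j _; rewrite -expr2 sqr_ge0.
Qed.

Lemma dot_eq0 x : dot x x <= 0 -> x = 0.
Proof.
move=> x0; apply/rowP => i; rewrite mxE; apply/eqP.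
by rewrite -sqrf_eq0 eq_le sqr_ge0 andbT (le_trans (le_sqr_coord x i)).
Qed.

Lemma dot_orth (Q : 'M[R]_n) x y : Q *m Q^T = 1%:M -> dot (x *m Q) (y *m Q) = dot x y.
Proof. by move=> QQ; rewrite !dotE trmx_mul mulmxA -(mulmxA x) QQ mulmx1. Qed.

Lemma unit_sphereP u : unit_sphere u <-> dot u u = 1.
Proof.
rewrite /unit_sphere/= /enorm; split => [u1|->]; last exact: sqrtr1.
by rewrite -(sqr_sqrtr (dot_ge0 u)) u1 expr1n.
Qed.

Lemma eballP y x (r : R) : 0 <= r -> eball x r y <-> dot (y - x) (y - x) <= r ^+ 2.
Proof.
move=> r0; rewrite /eball/= /enorm; split => h.
  by rewrite -(sqr_sqrtr (dot_ge0 _)) ler_sqr// nnegrE sqrtr_ge0.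
by rewrite -(ger0_norm r0) -sqrtr_sqr ler_wsqrtr.
Qed.

Lemma cvg_sum_ord {T : Type} (F : set_system T) (FF : Filter F) (m : nat)
    (f : 'I_m -> T -> R) (a : 'I_m -> R) :
  (forall i, f i x @[x --> F] --> a i) ->
  \sum_(i < m) f i x @[x --> F] --> \sum_(i < m) a i.
Proof. by move=> fa; apply: cvg_big => [|i _]; [exact: add_continuous|exact: fa]. Qed.

Lemma dot_continuous u : continuous (fun x => dot x u).
Proof.
move=> x; apply: (cvg_sum_ord (nbhs_filter x)) => i.
apply: cvgMr_tmp; exact: coord_continuous.
Qed.

Lemma sqdist_continuous y : continuous (fun x => dot (x - y) (x - y)).
Proof.
move=> x; apply: (cvg_sum_ord (nbhs_filter x)) => i.
have h : (fun x : 'rV[R]_n => (x - y) 0 i) @ x --> (x - y) 0 i.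
  under eq_fun do rewrite !mxE; rewrite !mxE.
  apply: (@cvgB _ _ _ (nbhs x) (nbhs_filter x)); first exact: coord_continuous.
  exact: (@cvg_cst _ _ _ (nbhs x) (nbhs_filter x)).
exact: (@cvgM _ _ (nbhs x) (nbhs_filter x)).
Qed.

Lemma measurable_dot u : measurable_fun setT (fun x => dot x u).
Proof.
apply: measurable_sum => i; apply: measurable_funM => //.
exact: measurable_coord.
Qed.

End dot_theory.

(** * Exact factors for orthogonal and diagonal matrices *)

Section orthogonal_invariance.
Context {R : realType}.

Definition box (n : nat) (r : R) : set 'rV[R]_n := [set x | forall i, `|x 0 i| <= r].

Let itvE (r : R) : `[- r, r]%classic = [set y : R | `|y| <= r].
Proof. by apply/seteqP; split => y /=; rewrite in_itv/= ler_norml. Qed.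

Lemma measurable_box n r : measurable (@box n r).
Proof.
by apply: (@measurable_rV_setX R n (fun=> [set y | `|y| <= r])) => i; rewrite -itvE.
Qed.

Lemma lebesgue_box n (r : R) : 0 <= r -> lebesgue_rV n (box r) = ((2 * r) ^+ n)%:E.
Proof.
move=> r0; rewrite (@lebesgue_rV_box R n (fun=> [set y | `|y| <= r])); last first.
  by move=> i; rewrite -itvE.
rewrite -itvE (eq_bigr (fun=> (2 * r)%:E)) => [|i _].
  by rewrite prodEFin prodr_const card_ord.
have := @lebesgue_measure_itv R `[- r, r]%O.
rewrite /= => ->; rewrite lte_fin; case: ifPn => [_|].
  by rewrite -EFinD; congr (_%:E); ring.
by rewrite -leNgt => h; congr (_%:E); lra.
Qed.

Lemma eball_box n (r : R) : @eball R n 0 r `<=` box r.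
Proof.
move=> x xr i.
have r0 : 0 <= r by apply: le_trans xr; exact: sqrtr_ge0.
move: xr => /(eballP _ _ r0); rewrite subr0 => xr.
by rewrite -ler_sqr ?nnegrE// real_normK ?num_real// (le_trans (le_sqr_coord x i)).
Qed.

(** The squared norm is at most [n], and [n <= n ^ 2] for a natural number, so the radius [n] avoids
    a square root. *)
Lemma box_eball n : box 1 `<=` @eball R n 0 n%:R.
Proof.
move=> x x1; apply/eballP => //; rewrite subr0.
apply: (@le_trans _ _ n%:R).
  rewrite /dot -[X in _ <= X%:R]card_ord -sumr_const; apply: ler_sum => i _.
  rewrite -expr2 -real_normK ?num_real//; have := x1 i; have := normr_ge0 (x 0 i); nra.
case: n x {x1} => [|m] _; first by rewrite expr2 mul0r.
by rewrite ler_eXnr// ler1n.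
Qed.

Lemma closed_eball n (c : 'rV[R]_n) r : 0 <= r -> closed (eball c r).
Proof.
move=> r0; rewrite (_ : eball c r = (fun y => dot (y - c) (y - c)) @^-1` [set z | z <= r ^+ 2]).
  apply: preimage_closed => [y _|]; [exact: sqdist_continuous|exact: closed_le].
by apply/seteqP; split => y /(eballP _ _ r0).
Qed.

Lemma mule_injr_pos (a b c : \bar R) : (0 < c)%E -> c \is a fin_num ->
  (a * c = b * c)%E -> a = b.
Proof.
move=> c0 cf abc; apply/eqP; rewrite eq_le.
by rewrite -(lee_pmul2r cf c0) abc lexx -(lee_pmul2r cf c0) abc lexx.
Qed.

(** [haar_uniqueness] is tested against a centred ball, which an orthogonal map preserves. The ball
    contains the unit box and lies in a larger one, so its measure is positive and finite and can be
    cancelled. *)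
Lemma lebesgue_rV_orth n (Q : 'M[R]_n) A : Q *m Q^T = 1%:M -> measurable A ->
  lebesgue_rV n ((fun x => x *m Q) @^-1` A) = lebesgue_rV n A.
Proof.
move=> QQ mA; have uQ := mulmx1_unit QQ.
pose B := @eball R n 0 n%:R.
have mB : measurable B by apply: closed_measurable_rV; exact: closed_eball.
have := haar_uniqueness uQ.1 mA mB.
rewrite (_ : _ @^-1` B = B); last first.
  apply/seteqP; split => x /eballP h; apply/eballP => //; move: h;
  by rewrite !subr0 dot_orth//; apply.
rewrite [RHS]muleC; apply: mule_injr_pos.
  apply: (@lt_le_trans _ _ (lebesgue_rV n (box 1))).
    by rewrite lebesgue_box// lte_fin exprn_gt0//; lra.
  by apply: le_measure; rewrite ?inE//; [exact: measurable_box|exact: box_eball].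
rewrite ge0_fin_numE//; apply: (@le_lt_trans _ _ (lebesgue_rV n (box n%:R))).
  by apply: le_measure; rewrite ?inE//; [exact: measurable_box|exact: eball_box].
by rewrite lebesgue_box// ltry.
Qed.

End orthogonal_invariance.

Section diagonal.
Context {R : realType}.

Let itvE (r : R) : `[- r, r]%classic = [set y : R | `|y| <= r].
Proof. by apply/seteqP; split => y /=; rewrite in_itv/= ler_norml. Qed.

(** Here the test set is the unit box: its preimage is again a box, with sides [2 / d_i], of
    explicit measure. *)
Lemma lebesgue_rV_diag n (d : 'rV[R]_n) A : (forall i, 0 < d 0 i) -> measurable A ->
  lebesgue_rV n ((fun x => x *m diag_mx d) @^-1` A) =
  (((\prod_i d 0 i)^-1)%:E * lebesgue_rV n A)%E.
Proof.
move=> d0 mA.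
have uD : diag_mx d \in unitmx.
  by rewrite unitmxE det_diag unitfE prodf_seq_neq0; apply/allP => i _; rewrite gt_eqF.
have mB := @measurable_box R n 1.
have := haar_uniqueness uD mA mB.
rewrite (_ : (fun x => x *m diag_mx d) @^-1` @box R n 1 =
    [set x : 'rV[R]_n | forall i, (fun i => [set y : R | `|y| <= (d 0 i)^-1]) i (x 0 i)]);
  last first.
  apply/seteqP; split => x /= xi i; have := xi i; rewrite mul_mx_diag mxE normrM (gtr0_norm (d0 i)).
    by rewrite -[(d 0 i)^-1]div1r ler_pdivlMr.
  by rewrite -[(d 0 i)^-1]div1r ler_pdivlMr.
rewrite (@lebesgue_rV_box R n (fun i => [set y : R | `|y| <= (d 0 i)^-1])); last first.
  by move=> i; rewrite -itvE.
rewrite lebesgue_box// mulr1.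
rewrite (eq_bigr (fun i => (2 / d 0 i)%:E)); last first.
  move=> i _; rewrite -itvE.
  have := @lebesgue_measure_itv R `[- (d 0 i)^-1, (d 0 i)^-1]%O.
  have := d0 i; rewrite -invr_gt0 => di.
  rewrite /= => ->; rewrite lte_fin gtrN// -EFinD; congr (_%:E); ring.
rewrite prodEFin big_split/= prodr_const card_ord -prodfV EFinM => h.
apply: (@mule_injr_pos _ _ _ (2 ^+ n)%:E); rewrite ?lte_fin ?exprn_gt0// h.
by rewrite -muleA muleC.
Qed.

End diagonal.

(** * Coordinates adapted to a family of parallel hyperplanes *)

Section chart.
Context {R : realType} {n : nat}.
Implicit Types (u v x : 'rV[R]_n.+1) (y : 'rV[R]_n) (s t : R).

Definition rV_tail x : 'rV[R]_n := \row_j x 0 (lift ord0 j).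

Lemma rV_cons_tail x : rV_cons (x 0 0, rV_tail x) = x.
Proof.
apply/rowP => i; case: (unliftP ord0 i) => [j ->|->]; last by rewrite rV_cons0.
by rewrite rV_consS mxE.
Qed.

Lemma rV_tail_cons p : rV_tail (rV_cons p) = p.2.
Proof. by apply/rowP => i; rewrite mxE rV_consS. Qed.

Lemma measurable_rV_tail : measurable_fun setT rV_tail.
Proof.
by apply: measurable_fun_rV => i; under eq_fun do rewrite mxE; exact: measurable_coord.
Qed.

Lemma orthonormal_frameP u : unit_sphere u ->
  is_orthonormal_frame u (orthonormal_frame u).
Proof.
by move=> u1; apply: (@getPex _ (is_orthonormal_frame u)); exact: orthonormal_frame_ex.
Qed.

Section frame.
Context u (u1 : unit_sphere u).
Let B : 'M[R]_(n, n.+1) := orthonormal_frame u.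
(** Completing [u] by its frame gives an orthogonal matrix, so the charts of all parallel
    hyperplanes fit together into one isometry of the whole space. *)
Let Q : 'M[R]_n.+1 := col_mx u B.

Let QQ : Q *m Q^T = 1%:M.
Proof.
have [BB Bu] := orthonormal_frameP u1.
have uu : u *m u^T = 1%:M.
  by apply/matrixP => i j; rewrite !ord1 -dotE ((unit_sphereP _).1 u1) mxE.
have uB : u *m B^T = 0 by rewrite -[LHS]trmxK trmx_mul trmxK Bu trmx0.
have QT : Q^T = row_mx u^T B^T := tr_col_mx u B.
rewrite QT; apply: (etrans (mul_col_row u B u^T B^T)).
by rewrite uu Bu BB uB -scalar_mx_block.
Qed.

Lemma chartE s y : hyperplane_chart u s y = rV_cons (s, y) *m Q.
Proof.
apply/esym; apply: (etrans (mul_row_col s%:M y u B)).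
by rewrite mul_scalar_mx.
Qed.

Lemma dot_chart s y s' y' :
  dot (hyperplane_chart u s y) (hyperplane_chart u s' y') = s * s' + dot y y'.
Proof.
rewrite !chartE dot_orth// /dot big_ord_recl !rV_cons0; congr (_ + _).
by apply: eq_bigr => i _; rewrite !rV_consS.
Qed.

Lemma chart_u : hyperplane_chart u 1 0 = u.
Proof. by rewrite /hyperplane_chart scale1r mul0mx addr0. Qed.

Lemma dot_chart_u s y : dot (hyperplane_chart u s y) u = s.
Proof. by rewrite -[X in dot _ X]chart_u dot_chart mulr1 dotC dot0l addr0. Qed.

Lemma chart_surj x : exists y, x = hyperplane_chart u (dot x u) y.
Proof.
have E : x = x *m Q^T *m Q by rewrite -mulmxA (mulmx1C QQ) mulmx1.
exists (rV_tail (x *m Q^T)).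
have -> : dot x u = (x *m Q^T) 0 0.
  rewrite {1}E -[X in X *m Q]rV_cons_tail -chartE dot_chart_u//.
by rewrite chartE rV_cons_tail.
Qed.

(** The map stretches the first coordinate by [e], translates it by [t] and then applies the
    orthogonal matrix [Q]; only the stretching changes the measure. The factor [e] prepares the
    blow-up near the hyperplane at level [t]. *)
Lemma lebesgue_chart t (e : R) (A : set 'rV[R]_n.+1) : 0 < e -> measurable A ->
  lebesgue_rV n.+1 ((fun z : 'rV[R]_n.+1 =>
    hyperplane_chart u (t + e * (z 0 0 : R)) (rV_tail z)) @^-1` A) =
  ((e^-1)%:E * lebesgue_rV n.+1 A)%E.
Proof.
move=> e0 mA.
pose d : 'rV[R]_n.+1 := rV_cons (e, const_mx 1).
pose A2 := (fun w => w *m Q) @^-1` A.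
have mA2 : measurable A2 by apply: measurable_preim => //; exact: measurable_mulmx.
pose b : 'rV[R]_n.+1 := rV_cons (t, 0).
pose A1 := (fun w => w + b) @^-1` A2.
have mA1 : measurable A1.
  apply: measurable_preim => //; apply: (@measurable_addv _ _ _ _ id (cst b)) => //.
have d0 i : 0 < d 0 i.
  case: (unliftP ord0 i) => [j ->|->]; first by rewrite rV_consS mxE.
  by rewrite rV_cons0.
have -> : (fun z : 'rV[R]_n.+1 => hyperplane_chart u (t + e * (z 0 0 : R)) (rV_tail z)) @^-1` A =
    (fun z : 'rV[R]_n.+1 => z *m diag_mx d) @^-1` A1.
  apply/seteqP.
  have E (z : 'rV[R]_n.+1) : hyperplane_chart u (t + e * (z 0 0 : R)) (rV_tail z) =
      (z *m diag_mx d + b) *m Q.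
    rewrite chartE; congr (_ *m _); apply/rowP => i.
    rewrite mul_mx_diag [RHS]mxE [X in _ = X + _]mxE.
    case: (unliftP ord0 i) => [j ->|->].
      by rewrite !rV_consS/= [const_mx _ _ _]mxE [X in _ = _ + X]mxE mulr1 addr0 mxE.
    by rewrite !rV_cons0/= mulrC addrC.
  by split => z; rewrite /preimage/= E.
rewrite lebesgue_rV_diag// lebesgue_rV_translate// lebesgue_rV_orth//.
rewrite big_ord_recl rV_cons0 big1 ?mulr1// => i _.
by rewrite rV_consS mxE.
Qed.

End frame.
End chart.

(** * Integrals of bounded functions with bounded support *)

Section tame.
Context {R : realType}.

(** The class of integrands for all changes of variables: it contains the truncations to a convex
    body of functions bounded on it, and makes both integrability and domination immediate. *)
Definition tame n (g : 'rV[R]_n -> R) := measurable_fun setT g /\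
  exists C r, [/\ 0 <= C, 0 <= r, forall x, `|g x| <= C & forall x, g x != 0 -> box r x].

Lemma tame_integrable n (g : 'rV[R]_n -> R) D : tame g -> measurable D ->
  (lebesgue_rV n).-integrable D (EFin \o g).
Proof.
move=> [mg [C [r [C0 r0 gC gr]]]] mD; apply: (@integrableS _ _ _ _ setT) => //.
have -> : EFin \o g = (EFin \o g) \_ (box r).
  apply/funext => x; rewrite patchE; case: ifPn => //=; rewrite notin_setE => xr.
  by congr (_%:E); apply/eqP; apply: contra_notT xr; exact: gr.
apply/(integrable_mkcond _ _).1; first exact: measurable_box.
apply: measurable_bounded_integrable; first exact: measurable_box.
- suff : (lebesgue_rV n (box r) < +oo)%E by [].
  by rewrite lebesgue_box// ltry.
- exact: measurable_funTS.
- exists C; split; first exact: num_real.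
  by move=> x Cx y _; rewrite /= (le_trans (gC y))// ltW.
Qed.

Lemma tameM n (g h : 'rV[R]_n -> R) : tame g -> measurable_fun setT h ->
  (exists C, forall x, g x != 0 -> `|h x| <= C) -> tame (fun x => h x * g x).
Proof.
move=> [mg [C [r [C0 r0 gC gr]]]] mh [M hM]; split; first exact: measurable_funM.
exists (`|M| * C), r; split => //; first exact: mulr_ge0.
- move=> x; have [->|gx] := eqVneq (g x) 0.
    by rewrite mulr0 normr0 mulr_ge0.
  by rewrite normrM ler_pM// (le_trans (hM _ gx))// ler_norm.
- by move=> x; rewrite mulf_eq0 negb_or => /andP[_ /gr].
Qed.

Lemma box_dot n (x : 'rV[R]_n) r : box r x -> dot x x <= n%:R * r ^+ 2.
Proof.
move=> xr; rewrite /dot -[X in X%:R]card_ord mulr_natl -sumr_const; apply: ler_sum => i _.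
by rewrite -expr2 -real_normK ?num_real// ler_sqr ?nnegrE// (le_trans _ (xr i)).
Qed.

(** Since [a <= 1 + a ^ 2], a square root is avoided; only boundedness matters. *)
Lemma dot_box n (x : 'rV[R]_n) C : dot x x <= C -> box (1 + C) x.
Proof.
move=> xC i; have := le_trans (le_sqr_coord x i) xC.
rewrite -real_normK ?num_real//; have := normr_ge0 (x 0 i).
set a := `|_|; nra.
Qed.

(** Expanding the squares of [x + y] and [x - y] gives a substitute for Cauchy-Schwarz wherever a
    crude bound is enough. *)
Lemma dot_bound n (x y : 'rV[R]_n) : `|dot x y| <= (dot x x + dot y y) / 2.
Proof.
have := dot_ge0 (x + y); have := dot_ge0 (x - y).
by rewrite !dot_linE (dotC y x) ler_norml; lra.
Qed.

Section frame.
Context {n : nat} (u : 'rV[R]_n.+1) (u1 : unit_sphere u).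

Lemma measurable_chart_map (t e : R) : measurable_fun setT
  (fun z : 'rV[R]_n.+1 => hyperplane_chart u (t + e * (z 0 0 : R)) (rV_tail z)).
Proof.
under eq_fun do rewrite chartE.
apply: (measurableT_comp (measurable_mulmx _)).
apply: (measurableT_comp (@measurable_rV_cons R n)).
apply/measurable_fun_pair; last exact: measurable_rV_tail.
apply: measurable_funD => //; apply: measurable_funM => //.
exact: measurable_coord.
Qed.

Lemma tame_chart_map (t e : R) g : 0 < e -> tame g ->
  tame (fun z : 'rV[R]_n.+1 => g (hyperplane_chart u (t + e * (z 0 0 : R)) (rV_tail z))).
Proof.
move=> e0 [mg [C [r [C0 r0 gC gr]]]]; split.
  by apply: (measurableT_comp mg); exact: measurable_chart_map.
pose D := n.+1%:R * r ^+ 2.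
have D0 : 0 <= D by rewrite mulr_ge0// sqr_ge0.
(* [D] bounds the squared Euclidean norm on the support of [g]. Hence [|t + e z_0| <= 1 + D], which
   bounds the first coordinate, and [1 + D] bounds the others. *)
exists C, (1 + (D + (1 + D + `|t|) / e)); split => //.
  by rewrite !addr_ge0// divr_ge0// ?addr_ge0// ltW.
move=> z /gr/box_dot; rewrite (dot_chart u1) -/D => h i.
have z0 : `|z 0 0| <= (1 + D + `|t|) / e.
  rewrite ler_pdivlMr// -(gtr0_norm e0) -normrM mulrC.
  have := dot_ge0 (rV_tail z); set s := e * _ in h *; move=> s0.
  have -> : s = (t + s) - t by ring.
  rewrite (le_trans (ler_normB _ _))// lerD2r.
  have : `|t + s| ^+ 2 <= D by rewrite real_normK ?num_real// expr2; lra.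
  have := normr_ge0 (t + s); set a := `|_|; nra.
have zt : box (1 + D) (rV_tail z).
  by apply: dot_box; apply: le_trans h; rewrite lerDr -expr2 sqr_ge0.
have E0 : 0 <= (1 + D + `|t|) / e by rewrite divr_ge0// ?addr_ge0// ltW.
case: (unliftP ord0 i) => [j ->|->]; last by apply: (le_trans z0); lra.
have := zt j; rewrite mxE => /le_trans; apply; lra.
Qed.

Lemma tame_chart (t : R) g : tame g -> tame (g \o hyperplane_chart u t).
Proof.
move=> [mg [C [r [C0 r0 gC gr]]]]; split.
  by apply: (measurableT_comp mg); exact: measurable_hyperplane_chart.
pose D := n.+1%:R * r ^+ 2.
have D0 : 0 <= D by rewrite mulr_ge0// sqr_ge0.
exists C, (1 + D); split => //; [exact: addr_ge0|by move=> y; exact: gC|].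
move=> y /= /gr/box_dot; rewrite (dot_chart u1) -/D => h.
by apply: dot_box; apply: le_trans h; rewrite lerDr -expr2 sqr_ge0.
Qed.

End frame.
End tame.

Section change_of_variables.
Context {R : realType}.

Lemma integral_mscale_tame n (k : {nonneg R}) (g : 'rV[R]_n -> R) : tame g ->
  (\int[mscale k (lebesgue_rV n)]_x (g x)%:E = k%:num%:E * \int[lebesgue_rV n]_x (g x)%:E)%E.
Proof.
move=> tg; have ig := tame_integrable tg measurableT.
have mg : measurable_fun setT (EFin \o g) by apply/measurable_EFinP; exact: tg.1.
rewrite [LHS]integralE [in RHS]integralE muleBr//.
  rewrite !ge0_integral_mscale//.
  - exact: measurable_funeneg.
  - exact: measurable_funepos.
exact: integrable_add_def.
Qed.

Lemma Rintegral_chart n (u : 'rV[R]_n.+1) (t e : R) g : unit_sphere u -> 0 < e -> tame g ->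
  \int[lebesgue_rV n.+1]_x g x =
  e * \int[lebesgue_rV n.+1]_z g (hyperplane_chart u (t + e * (z 0 0 : R)) (rV_tail z)).
Proof.
move=> u1 e0 tg.
pose P (z : 'rV[R]_n.+1) := hyperplane_chart u (t + e * (z 0 0 : R)) (rV_tail z).
have tgP : tame (g \o P) by exact: tame_chart_map.
have igP := tame_integrable tgP measurableT.
have mP : measurable_fun setT P := measurable_chart_map u t e.
have mg : measurable_fun setT (EFin \o g) by apply/measurable_EFinP; exact: tg.1.
have e1 : 0 <= e^-1 by rewrite invr_ge0 ltW.
have := @integral_pushforward _ _ _ _ _ P mP (lebesgue_rV n.+1) setT (EFin \o g) mg igP measurableT.
rewrite [X in X = _ -> _](_ : _ =
    (\int[mscale (NngNum e1) (lebesgue_rV n.+1)]_x (g x)%:E)%E); last first.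
  by apply: eq_measure_integral => A mA _; exact: (lebesgue_chart u1 t e0 mA).
rewrite preimage_setT integral_mscale_tame// /Rintegral => E.
rewrite [X in _ = _ * fine X](_ : _ = (\int[lebesgue_rV n.+1]_x ((EFin \o g) \o P) x)%E)// -E.
rewrite fineM//; last exact: integrable_fin_num (tame_integrable tg measurableT).
by rewrite /= mulrA mulfV ?mul1r// gt_eqF.
Qed.

Lemma integrable_rV_cons n (g : 'rV[R]_n.+1 -> \bar R) :
  (lebesgue_rV n.+1).-integrable setT g ->
  (lebesgue_measure \x lebesgue_rV n)%E.-integrable setT (g \o @rV_cons R n).
Proof.
move=> /integrableP[mg goo]; apply/integrableP; split.
  by apply: (measurableT_comp mg); exact: measurable_rV_cons.
have mag : measurable_fun setT (abse \o g) by exact: measurableT_comp.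
have := @ge0_integral_pushforward _ _ _ _ _ _ (@measurable_rV_cons R n)
  (lebesgue_measure \x lebesgue_rV n)%E setT (abse \o g) measurableT mag
  (fun y _ => abse_ge0 (g y)).
by rewrite preimage_setT /= => <-; exact: goo.
Qed.

Lemma Rintegral_rV_cons n (g : 'rV[R]_n.+1 -> R) : tame g ->
  \int[lebesgue_rV n.+1]_x g x =
  fine (\int[lebesgue_rV n]_y \int[lebesgue_measure]_s (g (rV_cons (s, y)))%:E).
Proof.
move=> tg; have ig := tame_integrable tg measurableT.
have igc := integrable_rV_cons ig.
rewrite /Rintegral; congr fine.
rewrite [RHS](integral21_prod_meas1 igc)/= /lebesgueS.
have mg : measurable_fun setT (EFin \o g) by apply/measurable_EFinP; exact: tg.1.
exact: (@integral_pushforward _ _ _ _ _ (@rV_cons R n) (@measurable_rV_cons R n)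
  (lebesgue_measure \x lebesgue_rV n)%E setT (EFin \o g) mg igc measurableT).
Qed.

End change_of_variables.

(** * The derivative of the integral over a rotating half-space *)

Section step.
Context {R : realType}.

Lemma measurable_step d (T : measurableType d) (a : R) (h : T -> R) :
  measurable_fun setT h -> measurable_fun setT (fun x : T => (a <= h x)%R%:R : R).
Proof.
move=> mh; rewrite (_ : (fun x : T => (a <= h x)%R%:R : R) =
  (\1_(`[a, +oo[%classic) : R -> R) \o h).
  by apply: (measurableT_comp _ mh); exact: measurable_indic.
by apply/funext => x /=; rewrite indicE; congr (_%:R); apply/esym; rewrite mem_setE in_itv/= andbT.
Qed.

Lemma norm_step_diff (p q : bool) : `|p%:R - q%:R| <= 1 :> R.
Proof.
by case: p; case: q; rewrite ?subrr ?subr0 ?sub0r ?normrN ?normr0 ?normr1.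
Qed.

(** Up to sign the difference of the two steps is the indicator of the interval between [0] and [a];
    the signed length [- a] covers both orders of the endpoints. *)
Lemma integral_step_diff (a c : R) :
  (\int[lebesgue_measure]_s (c * ((a <= s)%R%:R - (0 <= s)%R%:R))%:E = (- a * c)%:E)%E.
Proof.
have [a0|a0] := leP 0 a.
- transitivity (\int[lebesgue_measure]_s ((- c)%:E * (\1_(`[0, a[%classic) s)%:E))%E.
    apply: eq_integral => s _; rewrite -EFinM indicE mem_setE in_itv/=; congr (_%:E).
    have [as_|as_] := leP a s; have [s0|s0] := leP 0 s; rewrite /=; try ring; lra.
  rewrite integralZl//; last exact: (@integrable_indic_itv R 0 a true true).
  rewrite integral_indic// setIT.
  have := @lebesgue_measure_itv R `[0, a[%O; rewrite /= => ->.
  have [a1|a1] := ltP 0 a; rewrite lte_fin.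
    by rewrite a1 -EFinD -EFinM; congr (_%:E); ring.
  rewrite ltNge a1 /= mule0; congr (_%:E); have -> : a = 0 by apply/eqP; rewrite eq_le a0 a1.
  ring.
- transitivity (\int[lebesgue_measure]_s (c%:E * (\1_(`[a, 0[%classic) s)%:E))%E.
    apply: eq_integral => s _; rewrite -EFinM indicE mem_setE in_itv/=; congr (_%:E).
    have [as_|as_] := leP a s; have [s0|s0] := leP 0 s; rewrite /=; try ring; lra.
  rewrite integralZl//; last exact: (@integrable_indic_itv R a 0 true true).
  rewrite integral_indic// setIT.
  have := @lebesgue_measure_itv R `[a, 0[%O; rewrite /= => ->.
  by rewrite lte_fin a0 -EFinD -EFinM; congr (_%:E); ring.
Qed.

(** The exceptional set lies in a cylinder over a null set, whose product measure is
    [+oo * 0 = 0]. *)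
Lemma ae_rV_tail n (P : 'rV[R]_n -> Prop) :
  {ae lebesgue_rV n, forall y, P y} ->
  {ae lebesgue_rV n.+1, forall z : 'rV[R]_n.+1, P (rV_tail z)}.
Proof.
move=> [N [mN N0 PN]]; exists (@rV_tail R n @^-1` N); split.
- by apply: measurable_preim => //; exact: measurable_rV_tail.
- rewrite /= /lebesgueS /pushforward.
  rewrite (_ : _ @^-1` _ = setT `*` N).
    by rewrite product_measure1E// N0 mule0.
  by apply/seteqP; split => -[s y]/=; rewrite rV_tail_cons// => -[].
- by move=> z /= h; apply: PN.
Qed.

End step.

Section wedge.
Context {R : realType} {n : nat} (u v : 'rV[R]_n.+1) (u1 : unit_sphere u)
  (vu : dot v u = 0) (t beta : R) (g : 'rV[R]_n.+1 -> R) (tg : tame g).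

(** As [v] is orthogonal to [u], [b y] is the value of [<x, v>] above [y] on every parallel
    hyperplane. In the blown-up coordinates the difference of the two half-space indicators is
    [psi], free of [e]; only the argument of [g] in [H] still depends on [e]. *)
Let b (y : 'rV[R]_n) : R := dot (hyperplane_chart u 0 y) v.
Let psi (z : 'rV[R]_n.+1) : R :=
  (beta <= z 0 0 + b (rV_tail z))%R%:R - ((0 : R) <= z 0 0)%R%:R.
Let H (e : R) (z : 'rV[R]_n.+1) : R :=
  g (hyperplane_chart u (t + e * (z 0 0 : R)) (rV_tail z)) * psi z.

Let chartD s s' (y : 'rV[R]_n) :
  hyperplane_chart u (s + s') y = hyperplane_chart u s y + s' *: u.
Proof. by rewrite /hyperplane_chart scalerDl addrAC. Qed.

Lemma dot_chart_orth s y : dot (hyperplane_chart u s y) v = b y.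
Proof. by rewrite -(add0r s) chartD dotDl dotZl (dotC u) vu mulr0 addr0. Qed.

Let mpsi : measurable_fun setT psi.
Proof.
apply: measurable_funB; last by apply: measurable_step; exact: measurable_coord.
apply: measurable_step; apply: measurable_funD; first exact: measurable_coord.
apply: (measurableT_comp (measurable_dot v)).
apply: (measurableT_comp (measurable_hyperplane_chart u 0)).
exact: measurable_rV_tail.
Qed.

Let mH e : measurable_fun setT (H e).
Proof.
apply: measurable_funM => //.
apply: (measurableT_comp tg.1); exact: measurable_chart_map.
Qed.

(** Where [g] is nonzero the tail of [z] is bounded, and where [psi] is nonzero the first coordinate
    lies between [0] and [beta - b]. The resulting box does not depend on [e], as domination
    requires, unlike the support of the blown-up [g] alone, which grows as [e] decreases. *)
Let H_bound : exists C r, [/\ 0 <= C, 0 <= r, forall e z, `|H e z| <= C &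
  forall e z, H e z != 0 -> box r z].
Proof.
have [_ [C [r [C0 r0 gC gr]]]] := tg.
pose D := n.+1%:R * r ^+ 2.
have D0 : 0 <= D by rewrite mulr_ge0// sqr_ge0.
pose E := `|beta| + (D + dot v v) / 2.
have E0 : 0 <= E.
  by rewrite addr_ge0// divr_ge0// addr_ge0// dot_ge0.
have psi1 z : `|psi z| <= 1 by exact: norm_step_diff.
exists C, (E + (1 + D)); split => //.
- by rewrite addr_ge0// addr_ge0.
- by move=> e z; rewrite /H normrM -[leRHS]mulr1; apply: ler_pM => //; exact: gC.
move=> e z; rewrite mulf_eq0 negb_or => /andP[/gr/box_dot].
rewrite (dot_chart u1) -/D => h psi0 i.
have yD : dot (rV_tail z) (rV_tail z) <= D.
  by apply: le_trans h; rewrite lerDr -expr2 sqr_ge0.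
case: (unliftP ord0 i) => [j ->|->].
  have := dot_box yD j; rewrite mxE => /le_trans; apply; lra.
have bE : `|b (rV_tail z)| <= (D + dot v v) / 2.
  apply: (le_trans (dot_bound _ _)); rewrite (dot_chart u1); lra.
suff : `|z 0 0| <= E by lra.
have := ler_norm beta; have := ler_norm (- beta); rewrite normrN => hb1 hb2.
move: bE psi0; rewrite /psi /E !ler_norml => /andP[b1 b2].
have [h1|h1] := leP beta (z 0 0 + b (rV_tail z));
  have [h2|h2] := leP 0 (z 0 0); rewrite /= ?subrr ?eqxx// => _; apply/andP; split; lra.
Qed.

Let tameH e : tame (H e).
Proof.
have [C [r [C0 r0 HC Hr]]] := H_bound; split; first exact: mH.
exists C, r; split => //; exact: Hr.
Qed.

(** At [e = 0] the factor [g] is constant in the normal coordinate, and integrating [psi] in that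
    coordinate leaves the signed width of the wedge. *)
Let intH0 : \int[lebesgue_rV n.+1]_z H 0 z =
  \int[lebesgue_rV n]_y ((dot (hyperplane_chart u t y) v - beta) * g (hyperplane_chart u t y)).
Proof.
rewrite Rintegral_rV_cons//; congr fine; apply: eq_integral => y _.
under eq_integral => s _.
  rewrite /H /psi rV_tail_cons rV_cons0/= mul0r addr0 -lerBlDr.
  over.
by rewrite integral_step_diff dot_chart_orth opprB.
Qed.

Let intH e : 0 < e -> \int[lebesgue_rV n.+1]_z H e z =
  e^-1 * \int[lebesgue_rV n.+1]_x (((t + e * beta <= dot x u + e * dot x v)%R%:R -
    (t <= dot x u)%R%:R) * g x).
Proof.
move=> e0; set h := fun x => _ * g x.
have th : tame h.
  apply: tameM => //.
    apply: measurable_funB; apply: measurable_step; last exact: measurable_dot.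
    apply: measurable_funD; first exact: measurable_dot.
    by apply: measurable_funM => //; exact: measurable_dot.
  by exists 1 => x _; exact: norm_step_diff.
rewrite -[RHS]/(e^-1 * \int[lebesgue_rV n.+1]_x h x) (Rintegral_chart t u1 e0 th).
rewrite mulrA mulVf ?gt_eqF// mul1r; congr fine; apply: eq_integral => z _.
congr (_%:E); rewrite /H /h mulrC dot_chart_orth (dot_chart_u u1); congr (_ * _).
congr (_%:R - _%:R); first by rewrite -addrA -mulrDr lerD2l ler_pM2l.
by rewrite lerDl pmulr_rge0.
Qed.

(* The substitution x = t u + e s u + y B maps a fixed wedge onto the
   difference of the two half-spaces, with Jacobian e. *)
Lemma wedge_derivative (e_ : nat -> R) :
  {ae lebesgue_rV n, forall y, {for hyperplane_chart u t y, continuous g}} ->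
  (forall k, 0 < e_ k) -> e_ @ \oo --> (0 : R) ->
  (fun k => (e_ k)^-1 * \int[lebesgue_rV n.+1]_x
    (((t + e_ k * beta <= dot x u + e_ k * dot x v)%R%:R - (t <= dot x u)%R%:R) * g x)) @ \oo -->
  \int[lebesgue_rV n]_y ((dot (hyperplane_chart u t y) v - beta) * g (hyperplane_chart u t y)).
Proof.
move=> gcont e_0 ecvg; rewrite -intH0.
under eq_fun do rewrite -intH//.
have [C [r [C0 r0 HC Hr]]] := H_bound.
pose G (z : 'rV[R]_n.+1) : \bar R := (C * \1_(box r) z)%:E.
have mb := @measurable_box R n.+1 r.
have tG : tame (fun z : 'rV[R]_n.+1 => C * \1_(box r) z).
  split; first exact: measurable_funM.
  exists C, r; split => // z; rewrite indicE.
    by case: (z \in box r); rewrite ?mulr1 ?mulr0 ?normr0// ger0_norm.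
  by case: (boolP (z \in box r)) => [/set_mem//|_]; rewrite mulr0 eqxx.
have [] := @dominated_convergence _ _ _ (lebesgue_rV n.+1) setT measurableT
  (fun k => EFin \o H (e_ k)) (EFin \o H 0) G.
- by move=> k; apply/measurable_EFinP; exact: mH.
- by apply/measurable_EFinP; exact: mH.
(* The points at which [g] is evaluated converge to a point of the limit hyperplane, so continuity
   of [g] there suffices. *)
- apply: filterS (ae_rV_tail gcont) => z gz _.
  apply/fine_cvgP; split; first exact: nearW.
  rewrite /comp/= /H mul0r addr0; apply: cvgMr_tmp.
  set p := hyperplane_chart u t (rV_tail z) in gz *.
  have pcvg : (fun k => hyperplane_chart u (t + e_ k * z 0 0) (rV_tail z)) @ \oo --> p.
    under eq_fun do rewrite chartD.
    suff : (fun k => p + (e_ k * z 0 0) *: u) @ \oo --> p + (0 * z 0 0) *: u.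
      by rewrite mul0r scale0r addr0.
    apply: cvgD; first exact: cvg_cst.
    by apply: cvgZr_tmp; apply: cvgMr_tmp.
  have hh := @cvg_comp _ _ _ _ g _ _ _ pcvg gz. exact hh.
- exact: tame_integrable tG measurableT.
- apply: aeW => z k _ /=; rewrite lee_fin.
  have [->|hz] := eqVneq (H (e_ k) z) 0.
    by rewrite normr0 mulr_ge0.
  by rewrite indicE mem_set ?mulr1//; exact: Hr hz.
move=> iH _ cH; apply: fine_cvg.
rewrite fineK; first exact: cH.
exact: (integrable_fin_num measurableT iH).
Qed.

End wedge.

(** * Caps and sections of convex bodies *)

Section convex_bodies.
Context {R : realType} {n : nat}.
Implicit Types (K : set 'rV[R]_n) (x y u v : 'rV[R]_n).

Lemma convex_setP K : convex_set K <-> forall x y (l : R), K x -> K y ->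
  0 <= l -> l <= 1 -> K (l *: x + (1 - l) *: y).
Proof.
split => cK x y l.
  move=> Kx Ky l0 l1; have := cK x y (Itv01 l0 l1).
  by rewrite !inE; apply.
rewrite !inE => Kx Ky; exact: (cK x y l%:num Kx Ky (ge0 l) (le1 l)).
Qed.

Lemma convex_body_measurable K : convex_body K -> measurable K.
Proof.
move=> [cK _ _]; apply: closed_measurable_rV.
by apply: compact_closed => //; exact: norm_hausdorff.
Qed.

Lemma normr_rVP x r : 0 <= r -> `|x| <= r <-> box r x.
Proof.
move=> r0; rewrite /box/=; split => [xr i|xr].
  apply: le_trans xr; rewrite [leRHS]/Num.norm /= mx_normrE.
  by apply/bigmax_geP; right => /=; exists (0, i).
rewrite [leLHS]/Num.norm /= mx_normrE; apply/bigmax_leP; split => //= -[i j] _.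
by rewrite ord1.
Qed.

Lemma convex_body_box K : convex_body K -> exists2 r, 0 <= r & K `<=` box r.
Proof.
move=> [/compact_bounded [M [Mr MK]] _ _].
exists (`|M| + 1) => [|x Kx]; first exact: addr_ge0.
apply/normr_rVP; first exact: addr_ge0.
by apply: MK => //; rewrite ltr_pwDr// ler_norm.
Qed.

(** A point near the combination is the same combination of [x] and a point near [p]; the admissible
    radius shrinks by the factor [1 - l]. *)
Lemma convex_interior K p x (l : R) : convex_set K -> K° p -> K x -> 0 <= l -> l < 1 ->
  K° (l *: x + (1 - l) *: p).
Proof.
move=> /convex_setP cK /nbhs_rVP[e e0 eK] Kx l0 l1.
have l1' : 0 < 1 - l by rewrite subr_gt0.
apply/nbhs_rVP; exists ((1 - l) * e); first exact: mulr_gt0.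
move=> y yK.
have -> : y = l *: x + (1 - l) *: ((1 - l)^-1 *: (y - l *: x)).
  by rewrite scalerA mulfV ?gt_eqF// scale1r addrC subrK.
apply: cK => //; last exact: ltW.
apply: eK => i; rewrite -(ltr_pM2l l1') -[X in X * `|_|](gtr0_norm l1') -normrM.
have := yK i; rewrite !mxE; congr (`|_| < _); field; exact: lt0r_neq0.
Qed.

End convex_bodies.

Section slab.
Context {R : realType} {n : nat}.
Implicit Types (K : set 'rV[R]_n.+1) (u : 'rV[R]_n.+1).

(** In the chart of [u] the set lies in an interval of length [s' - s] times a box of fixed size, so
    the constant is uniform in the direction. *)
Lemma slab_measure (r : R) : exists2 C : R, 0 <= C & forall u (s s' : R),
  unit_sphere u -> s <= s' ->
  (lebesgue_rV n.+1 (box r `&` [set x | (s <= dot x u <= s')%R]) <= (C * (s' - s))%:E)%E.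
Proof.
pose D := n.+1%:R * r ^+ 2.
have D0 : 0 <= D by rewrite mulr_ge0// sqr_ge0.
have D1 : 0 <= 1 + D by exact: addr_ge0.
exists ((2 * (1 + D)) ^+ n) => [|u s s' u1 ss'].
  by rewrite exprn_ge0// mulr_ge0.
set A := box r `&` _.
have mA : measurable A.
  apply: measurableI; first exact: measurable_box.
  rewrite (_ : [set x | _] = (fun x => dot x u) @^-1` `[s, s']%classic).
    by apply: measurable_preim => //; exact: measurable_dot.
  by apply/seteqP; split => x /=; rewrite in_itv.
have := lebesgue_chart u1 0 ltr01 mA; rewrite invr1 mul1e => <-.
set P := _ @^-1` A.
have mP : measurable P by apply: measurable_preim => //; exact: measurable_chart_map.
have mQ : measurable (`[s, s']%classic `*` box (1 + D) : set (measurableTypeR R * 'rV[R]_n)).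
  by apply: measurableX => //; exact: measurable_box.
have PQ : @rV_cons R n @^-1` P `<=` `[s, s']%classic `*` box (1 + D).
  move=> [z y]; rewrite /P /A/= rV_cons0 rV_tail_cons/= add0r mul1r.
  rewrite (dot_chart_u u1) => -[/box_dot h ?]; split; first by rewrite /= in_itv.
  apply: dot_box; apply: le_trans h; rewrite (dot_chart u1) -expr2 /D.
  by rewrite lerDr sqr_ge0.
apply: (@le_trans _ _ ((lebesgue_measure \x lebesgue_rV n)%E (`[s, s']%classic `*` box (1 + D)))).
  apply: (@le_measure _ _ _ (lebesgue_measure \x lebesgue_rV n)%E); rewrite ?inE//.
  by apply: measurable_preim => //; exact: measurable_rV_cons.
rewrite product_measure1E//; last exact: measurable_box.
have := @lebesgue_measure_itv R `[s, s']%O; rewrite /= => ->.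
rewrite lebesgue_box// lte_fin.
have [ss|ss] := ltP s s'; first by rewrite -EFinD -EFinM lee_fin mulrC.
by rewrite mul0e lee_fin mulr_ge0// ?subr_ge0// exprn_ge0// mulr_ge0.
Qed.

Lemma convex_body_vol K : convex_body K -> lebesgue_rV n.+1 K = (vol K)%:E /\ 0 < vol K.
Proof.
move=> hK; have mK := convex_body_measurable hK; have [r r0 Kr] := convex_body_box hK.
have Kfin : lebesgue_rV n.+1 K \is a fin_num.
  rewrite ge0_fin_numE//; apply: (@le_lt_trans _ _ (lebesgue_rV n.+1 (box r))).
    by apply: le_measure; rewrite ?inE//; exact: measurable_box.
  by rewrite lebesgue_box// ltry.
rewrite /vol fineK//; split => //; apply: fine_gt0.
rewrite ltey_eq Kfin andbT.
have [_ _ [p /nbhs_rVP[e e0 eK]]] := hK.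
have e1 : 0 <= e / 2 by rewrite divr_ge0// ltW.
pose B := (fun x : 'rV[R]_n.+1 => x - p) @^-1` box (e / 2).
have mB : measurable B.
  apply: measurable_preim; last exact: measurable_box.
  exact: (measurable_addv (f := id) (g := cst (- p))).
apply: (@lt_le_trans _ _ (lebesgue_rV n.+1 B)).
  rewrite lebesgue_rV_translate; last exact: measurable_box.
  by rewrite lebesgue_box// lte_fin exprn_gt0// mulr_gt0// divr_gt0.
apply: le_measure; rewrite ?inE// => x xB; apply: eK => i.
have := xB i; rewrite !mxE distrC => /le_lt_trans; apply; lra.
Qed.

End slab.

Section cuts.
Context {R : realType} {n : nat} (K : set 'rV[R]_n.+1) (hK : convex_body K).
Implicit Types (u : 'rV[R]_n.+1) (s t : R).

Let mK := convex_body_measurable hK.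

Lemma measurable_halfspace_ge u t : measurable (halfspace_ge u t).
Proof.
rewrite (_ : halfspace_ge u t = (fun x => dot x u) @^-1` `[t, +oo[%classic).
  by apply: measurable_preim => //; exact: measurable_dot.
by apply/seteqP; split => x /=; rewrite in_itv/= andbT.
Qed.

Let mcap u t : measurable (K `&` halfspace_ge u t).
Proof. by apply: measurableI => //; exact: measurable_halfspace_ge. Qed.

Lemma lebesgue_rV_vol (A : set 'rV[R]_n.+1) : measurable A -> A `<=` K ->
  lebesgue_rV n.+1 A = (vol A)%:E.
Proof.
move=> mA AK; rewrite /vol fineK// ge0_fin_numE//.
apply: (@le_lt_trans _ _ (lebesgue_rV n.+1 K)); first by apply: le_measure; rewrite ?inE.
by rewrite (convex_body_vol hK).1 ltry.
Qed.

Lemma vol_cap_lip : exists2 C : R, 0 <= C & forall u s s', unit_sphere u -> s <= s' ->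
  vol (K `&` halfspace_ge u s') <= vol (K `&` halfspace_ge u s) /\
  vol (K `&` halfspace_ge u s) <= vol (K `&` halfspace_ge u s') + C * (s' - s).
Proof.
have [r r0 Kr] := convex_body_box hK.
have [C C0 slab] := @slab_measure R n r.
exists C => // u s s' u1 ss'; split.
  rewrite -lee_fin -!lebesgue_rV_vol//; try exact: subIsetl.
  apply: le_measure; rewrite ?inE//; apply: setIS => x; rewrite /halfspace_ge/=; lra.
rewrite -lee_fin EFinD -!lebesgue_rV_vol//; try exact: subIsetl.
have mS : measurable (box r `&` [set x | (s <= dot x u <= s')%R]).
  apply: measurableI; first exact: measurable_box.
  rewrite (_ : [set x | _] = (fun x => dot x u) @^-1` `[s, s']%classic).
    by apply: measurable_preim => //; exact: measurable_dot.
  by apply/seteqP; split => x /=; rewrite in_itv.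
apply: le_trans (leeD2l _ (slab u s s' u1 ss')).
apply: le_trans (measureU2 _ _ _) => //.
apply: le_measure; rewrite ?inE//; first exact: measurableU.
move=> x [Kx]; rewrite /halfspace_ge/= => xs.
have [h|h] := leP s' (dot x u); [left => //|right].
by split; [exact: Kr|rewrite /= xs ltW].
Qed.

Lemma dot_bounded u : exists2 L, 0 <= L & forall x, K x -> `|dot x u| <= L.
Proof.
have [r r0 Kr] := convex_body_box hK.
exists ((n.+1%:R * r ^+ 2 + dot u u) / 2).
  by rewrite divr_ge0// addr_ge0// ?mulr_ge0 ?sqr_ge0// dot_ge0.
move=> x /Kr /box_dot xr; apply: (le_trans (dot_bound _ _)); lra.
Qed.

Section level.
Variables (delta : R) (d0 : 0 < delta) (d1 : delta < 1).

Lemma cut_levelP u : unit_sphere u ->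
  vol (K `&` halfspace_ge u (cut_level K delta u)) = delta * vol K.
Proof.
move=> u1.
apply: (@getPex _ [set t | vol (K `&` halfspace_ge u t) = delta * vol K]).
have [C C0 lip] := vol_cap_lip.
have [L L0 KL] := dot_bounded u.
pose V t := vol (K `&` halfspace_ge u t).
have Vcont : continuous V.
  move=> s; apply/cvgrPdist_le => e e0.
  have C1 : 0 < C + 1 by rewrite ltr_pwDr.
  near=> s'.
  have ss' : `|s - s'| <= e / (C + 1).
    by near: s'; apply: cvgr_dist_le => //; exact: divr_gt0.
  rewrite ler_pdivlMr// in ss'.
  have [h|/ltW h] := leP s s'; have [] := lip u _ _ u1 h; rewrite -/(V s) -/(V s').
    move: ss'; rewrite distrC (ger0_norm (_ : 0 <= s' - s)) ?subr_ge0// => ss' V1 V2.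
    by rewrite ler_norml; apply/andP; split; nra.
  move: ss'; rewrite (ger0_norm (_ : 0 <= s - s')) ?subr_ge0// => ss' V1 V2.
  by rewrite ler_norml; apply/andP; split; nra.
have v0 := (convex_body_vol hK).2.
have VL : V (- L) = vol K.
  rewrite /V; congr vol; apply/seteqP; split => [x []//|x Kx]; split => //.
  by rewrite /halfspace_ge/=; have := KL x Kx; rewrite ler_norml => /andP[].
(* At level [L] the half-space may still touch [K]; one unit further it misses it. *)
have VL1 : V (L + 1) = 0.
  rewrite /V (_ : _ `&` _ = set0) ?/vol ?measure0// -subset0 => x [Kx].
  by rewrite /halfspace_ge/=; have := KL x Kx; rewrite ler_norml => /andP[]; lra.
have LL : - L <= L + 1 by lra.
have [||c _ cE] := @IVT R V (- L) (L + 1) (delta * vol K) LL.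
- by apply: continuous_subspaceT.
- rewrite VL VL1 min_r ?(ltW v0)// max_l ?(ltW v0)//.
  apply/andP; split; first exact: mulr_ge0 (ltW d0) (ltW v0).
  by rewrite ger_pMl ?ltW.
by exists c.
Unshelve. all: by end_near. Qed.

(** Since [0 < delta < 1], [K] has points strictly on both sides of the level: otherwise the cap
    would be all of [K], or lie in a slab of width zero. The segment from an interior point to a
    point beyond the level crosses it inside the interior. *)
Lemma cut_level_interior u : unit_sphere u ->
  exists2 p, K° p & dot p u = cut_level K delta u.
Proof.
move=> u1; set t := cut_level K delta u.
have Vt := cut_levelP u1; rewrite -/t in Vt.
have v0 := (convex_body_vol hK).2.
have [q1 Kq1 q1t] : exists2 q, K q & dot q u < t.
  apply: contrapT => h; suff E : K `&` halfspace_ge u t = K.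
    have : 0 < (1 - delta) * vol K by rewrite mulr_gt0// subr_gt0.
    by move: Vt; rewrite E mulrBl mul1r => <-; rewrite subrr ltxx.
  apply/seteqP; split => [x []//|x Kx]; split => //; rewrite /halfspace_ge/= leNgt.
  by apply/negP => xt; apply: h; exists x.
have [q2 Kq2 q2t] : exists2 q, K q & t < dot q u.
  apply: contrapT => h; have [r r0 Kr] := convex_body_box hK.
  have [C C0 slab] := @slab_measure R n r.
  suff : (lebesgue_rV n.+1 (K `&` halfspace_ge u t) <= 0)%E.
    rewrite (lebesgue_rV_vol (mcap u t) (@subIsetl _ _ _)).
    by rewrite Vt lee_fin leNgt mulr_gt0.
  have := slab u t t u1 (lexx t); rewrite subrr mulr0; apply: le_trans.
  apply: le_measure; rewrite ?inE//.
    apply: measurableI; first exact: measurable_box.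
    rewrite (_ : [set x | _] = (fun x => dot x u) @^-1` `[t, t]%classic).
      by apply: measurable_preim => //; exact: measurable_dot.
    by apply/seteqP; split => x /=; rewrite in_itv.
  move=> x [Kx]; rewrite /halfspace_ge/= => tx; split; first exact: Kr.
  by rewrite /= tx leNgt; apply/negP => xt; apply: h; exists x.
have [_ cK [p Kp]] := hK.
have seg q (l : R) : K q -> 0 <= l -> l < 1 -> K° (l *: q + (1 - l) *: p).
  by move=> Kq l0 l1; exact: convex_interior.
have [pt|pt|pt] := ltgtP (dot p u) t; last by exists p.
- pose l := (t - dot p u) / (dot q2 u - dot p u).
  have den : 0 < dot q2 u - dot p u by lra.
  exists (l *: q2 + (1 - l) *: p).
    by apply: seg => //; rewrite /l ?ler_pdivlMr ?ltr_pdivrMr//; lra.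
  by rewrite !dot_linE /l; field; exact: lt0r_neq0.
- pose l := (dot p u - t) / (dot p u - dot q1 u).
  have den : 0 < dot p u - dot q1 u by lra.
  exists (l *: q1 + (1 - l) *: p).
    by apply: seg => //; rewrite /l ?ler_pdivlMr ?ltr_pdivrMr//; lra.
  by rewrite !dot_linE /l; field; exact: lt0r_neq0.
Qed.

End level.
End cuts.

Section section_boundary.
Context {R : realType} {n : nat} (K : set 'rV[R]_n.+1) (hK : convex_body K).
Context (u : 'rV[R]_n.+1) (u1 : unit_sphere u) (t : R).

Let chart := hyperplane_chart u t.

(** Bernoulli's inequality, which bounds the relative measure lost under a homothety of ratio
    [l]. *)
Lemma onem_expn_le (l : R) : 0 <= l -> l <= 1 -> 1 - l ^+ n <= n%:R * (1 - l).
Proof.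
move=> l0 l1; elim: n => [|m IH]; first by rewrite expr0 subrr mul0r.
have : l ^+ m * (1 - l) <= 1 - l.
  by rewrite ler_piMl ?subr_ge0// exprn_ile1.
rewrite exprS -natr1; lra.
Qed.

Lemma measurable_interior_rV m (A : set 'rV[R]_m) : measurable A°.
Proof. by apply: open_measurable_rV; exact: open_interior. Qed.

(* The homotheties of ratio l < 1 centered at an interior point of the section
   map the section into the interior of K; let l tend to 1. *)
Lemma section_boundary_null : (exists2 p, K° p & dot p u = t) ->
  lebesgue_rV n (chart @^-1` (K `\` K°)) = 0.
Proof.
move=> [p Kp pt].
have mK := convex_body_measurable hK.
have mc : measurable_fun setT chart := measurable_hyperplane_chart u t.
pose S := chart @^-1` K; pose D := chart @^-1` (K `\` K°).
have mS : measurable S by exact: measurable_preim.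
have mD : measurable D.
  by apply: measurable_preim => //; apply: measurableD => //; exact: measurable_interior_rV.
have [r r0 Kr] := convex_body_box hK.
have Sbox : S `<=` box (1 + n.+1%:R * r ^+ 2).
  move=> y /Kr /box_dot h; apply: dot_box; apply: le_trans h.
  by rewrite (dot_chart u1) lerDr -expr2 sqr_ge0.
have Sfin : lebesgue_rV n S \is a fin_num.
  rewrite ge0_fin_numE//.
  apply: (@le_lt_trans _ _ (lebesgue_rV n (box (1 + n.+1%:R * r ^+ 2)))).
    by apply: le_measure; rewrite ?inE//; exact: measurable_box.
  by rewrite lebesgue_box ?ltry// addr_ge0// mulr_ge0// sqr_ge0.
have Dfin : lebesgue_rV n D \is a fin_num.
  rewrite ge0_fin_numE//; apply: (@le_lt_trans _ _ (lebesgue_rV n S)).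
    by apply: le_measure; rewrite ?inE// => y [].
  by rewrite -ge0_fin_numE.
set s := fine (lebesgue_rV n S); set d := fine (lebesgue_rV n D).
have sE : lebesgue_rV n S = s%:E by rewrite /s fineK.
have dE : lebesgue_rV n D = d%:E by rewrite /d fineK.
have s0 : 0 <= s by rewrite /s fine_ge0.
have d0 : 0 <= d by rewrite /d fine_ge0.
have [y0 y0p] := chart_surj u1 p; rewrite pt -/chart in y0p.
have key (l : R) : 0 < l -> l < 1 -> d <= (1 - l ^+ n) * s.
  move=> l0 l1.
  (* [W] is the image of [S] under the homothety of ratio [l] centred at [y0], written as a
     preimage. It avoids [D], and both lie in [S]. *)
  pose W := (fun w => w *m diag_mx (const_mx l^-1)) @^-1`
    ((fun w => w + (y0 - l^-1 *: y0)) @^-1` S).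
  have mT : measurable ((fun w : 'rV[R]_n => w + (y0 - l^-1 *: y0)) @^-1` S).
    apply: measurable_preim => //.
    exact: (measurable_addv (f := id) (g := cst (y0 - l^-1 *: y0))).
  have mW : measurable W by apply: measurable_preim => //; exact: measurable_mulmx.
  have WE : lebesgue_rV n W = (l ^+ n * s)%:E.
    rewrite /W lebesgue_rV_diag//; last by move=> i; rewrite mxE invr_gt0.
    rewrite lebesgue_rV_translate// sE -EFinM; congr (_ * _)%:E.
    under eq_bigr do rewrite mxE.
    by rewrite prodr_const card_ord exprVn invrK.
  have WK : W `<=` chart @^-1` K°.
    move=> w; rewrite /W/= mul_mx_diag => Kw.
    have [_ cK _] := hK.
    have := convex_interior cK Kp Kw (ltW l0) l1; rewrite y0p; congr (K° _).
    rewrite /chart /hyperplane_chart !scalerDr addrACA -scalerDl subrKC scale1r.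
    rewrite !scalemxAl -mulmxDl; congr (_ + _ *m _).
    apply/rowP => i; rewrite !mxE; field; exact: lt0r_neq0.
  have DW : [disjoint D & W].
    by apply/disj_setPS => w [[_ wD] /WK].
  have : (lebesgue_rV n (D `|` W) <= lebesgue_rV n S)%E.
    apply: le_measure; rewrite ?inE//; first exact: measurableU.
    by move=> w [[]//|/WK /interior_subset].
  have -> : lebesgue_rV n (D `|` W) = (lebesgue_rV n D + lebesgue_rV n W)%E.
    by rewrite measureU//; exact/eqP.
  by rewrite WE sE dE -EFinD lee_fin; lra.
have d00 : d = 0.
  apply/eqP; rewrite eq_le d0 andbT leNgt; apply/negP => dpos.
  have ns : 0 <= n%:R * s by rewrite mulr_ge0.
  (* For [1 - l = d / q] the bound becomes [d (n s / q)], which is less than [d] because [q > n s];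
     [q > d] keeps [l] positive. *)
  pose q := n%:R * s + d + 1; have q0 : 0 < q by rewrite /q; lra.
  have l0 : 0 < 1 - d / q by rewrite subr_gt0 ltr_pdivrMr// mul1r /q; lra.
  have l1 : 1 - d / q < 1 by rewrite gtrBl divr_gt0.
  have := key _ l0 l1; apply/negP; rewrite -ltNge.
  apply: (@le_lt_trans _ _ (n%:R * (1 - (1 - d / q)) * s)).
    by rewrite ler_wpM2r// onem_expn_le// ltW.
  rewrite (_ : _ * s = d * (n%:R * s / q)); last by field; exact: lt0r_neq0.
  by rewrite gtr_pMr// ltr_pdivrMr// mul1r /q; lra.
by rewrite -/D dE d00.
Qed.

(** Off [K \ K°] the truncation is locally [f] or locally zero, because [K] is closed. *)
Lemma ae_continuous_section (f : 'rV[R]_n.+1 -> R) : continuous f ->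
  (exists2 p, K° p & dot p u = t) ->
  {ae lebesgue_rV n, forall y, {for chart y, continuous (f \_ K)}}.
Proof.
move=> cf hp; exists (chart @^-1` (K `\` K°)); split.
- apply: (measurable_preim (measurable_hyperplane_chart u t)).
  exact: (measurableD (convex_body_measurable hK) (measurable_interior_rV K)).
- exact: section_boundary_null.
move=> y /= nc; apply: contrapT => yD; apply: nc.
have [Ky|nKy] := pselect (K (chart y)).
  have Kiy : K° (chart y) by apply: contrapT => h; apply: yD.
  rewrite /prop_for /continuous_at patchE mem_set//.
  apply: cvg_trans (cf (chart y)); apply: (@near_eq_cvg _ _ (nbhs (chart y)) (nbhs_filter _)).
  apply: (@filterS _ (nbhs (chart y)) (nbhs_filter _) K) => // x Kx.
  by rewrite patchE mem_set.
rewrite /prop_for /continuous_at patchE memNset//.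
have [cK _ _] := hK.
have oK : open (~` K) by apply: closed_openC; apply: compact_closed => //; exact: norm_hausdorff.
apply: cvg_trans (@cvg_cst _ (0 : R) _ (nbhs (chart y)) (nbhs_filter _)).
apply: (@near_eq_cvg _ _ (nbhs (chart y)) (nbhs_filter _)).
apply: (@filterS _ (nbhs (chart y)) (nbhs_filter _) (~` K)) => [x Kx|].
  by rewrite patchE memNset.
exact: open_nbhs_nbhs.
Qed.

End section_boundary.

Section row_integral.
Context d {T : measurableType d} {R : realType} (mu : {measure set T -> \bar R}) (D : set T)
  (mD : measurable D).

Lemma Rintegral_sum (I : Type) (s : seq I) (f : I -> T -> R) :
  (forall i, mu.-integrable D (EFin \o f i)) ->
  \int[mu]_(x in D) (\sum_(i <- s) f i x) = \sum_(i <- s) \int[mu]_(x in D) f i x.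
Proof.
move=> fi; pose g i x := \sum_(j <- i) f j x.
suff H : mu.-integrable D (EFin \o g s) /\
    \int[mu]_(x in D) g s x = \sum_(i <- s) \int[mu]_(x in D) f i x by exact: H.2.
elim: s => [|i s [IH1 IH2]].
  rewrite (_ : g [::] = cst 0); last by apply/funext => x; rewrite /g big_nil.
  by rewrite Rintegral_cst// mul0r big_nil; split => //; exact: integrable0.
have gE : g (i :: s) = (fun x => f i x + g s x).
  by apply/funext => x; rewrite /g big_cons.
rewrite gE RintegralD// IH2 big_cons; split => //.
by rewrite (_ : EFin \o _ = (EFin \o f i) \+ (EFin \o g s))//; exact: integrableD.
Qed.

End row_integral.

Lemma dot_row_Rintegral (R : realType) n d (T : measurableType d) (mu : {measure set T -> \bar R})
    (D : set T) (phi : T -> 'rV[R]_n) (c : R) (e : 'rV[R]_n) :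
  measurable D -> (forall i, mu.-integrable D (EFin \o (fun x => phi x 0 i))) ->
  dot (\row_i (c * \int[mu]_(x in D) phi x 0 i)) e = c * \int[mu]_(x in D) dot (phi x) e.
Proof.
move=> mD hi; rewrite /dot Rintegral_sum//.
  rewrite mulr_sumr; apply: eq_bigr => i _; rewrite mxE -mulrA; congr (_ * _).
  by rewrite RintegralZr.
by move=> i; under eq_fun do rewrite mulrC; apply: (integrableZl mD (e 0 i) (hi i)).
Qed.

(** * Integration over a section *)

Section bounded_on.
Context {R : realType} {n : nat} (K : set 'rV[R]_n.+1) (hK : convex_body K).

Definition bounded_on (f : 'rV[R]_n.+1 -> R) :=
  measurable_fun setT f /\ exists C, forall x, K x -> `|f x| <= C.

Lemma bounded_on_cst c : bounded_on (cst c).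
Proof. by split => //; exists `|c|. Qed.

Lemma bounded_on_dot e : bounded_on (fun x => dot x e).
Proof.
split; first exact: measurable_dot.
by have [L _ KL] := dot_bounded hK e; exists L.
Qed.

Lemma bounded_onM f g : bounded_on f -> bounded_on g -> bounded_on (fun x => f x * g x).
Proof.
move=> [mf [C fC]] [mg [D gD]]; split; first exact: measurable_funM.
by exists (C * D) => x Kx; rewrite normrM ler_pM// ?fC ?gD.
Qed.

Lemma bounded_onD f g : bounded_on f -> bounded_on g -> bounded_on (fun x => f x + g x).
Proof.
move=> [mf [C fC]] [mg [D gD]]; split; first exact: measurable_funD.
by exists (C + D) => x Kx; rewrite (le_trans (ler_normD _ _))// lerD ?fC ?gD.
Qed.

Lemma bounded_onZ c f : bounded_on f -> bounded_on (fun x => c * f x).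
Proof. by apply: bounded_onM; exact: bounded_on_cst. Qed.

Lemma bounded_onB f g : bounded_on f -> bounded_on g -> bounded_on (fun x => f x - g x).
Proof.
move=> hf hg; have := bounded_onD hf (bounded_onZ (-1) hg).
by under [X in bounded_on X]eq_fun do rewrite mulN1r.
Qed.

Lemma tame_restrict f : bounded_on f -> tame (f \_ K).
Proof.
move=> [mf [C fC]].
have [r r0 Kr] := convex_body_box hK.
have [_ _ [p /interior_subset Kp]] := hK.
have C0 : 0 <= C by apply: le_trans (fC p Kp).
split.
  apply/(measurable_restrict f (convex_body_measurable hK) measurableT).
  exact: measurable_funTS.
exists C, r; split => //.
  by move=> x; rewrite patchE; case: ifPn => [/set_mem /fC//|_]; rewrite normr0.
by move=> x; rewrite patchE; case: ifPn => [/set_mem /Kr//|_]; rewrite eqxx.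
Qed.

Section section_integral.
Context (u : 'rV[R]_n.+1) (u1 : unit_sphere u) (t : R).

(** Written in the chart, where it has the shape of the limit in [wedge_derivative];
    [Rintegral_hyperplane] identifies it with the integral for the hyperplane measure. *)
Definition section_integral f := \int[lebesgue_rV n]_y (f \_ K) (hyperplane_chart u t y).

Let integrable_sec f : bounded_on f ->
  (lebesgue_rV n).-integrable setT (EFin \o ((f \_ K) \o hyperplane_chart u t)).
Proof.
move=> hf; apply: tame_integrable => //; apply: tame_chart => //.
exact: tame_restrict.
Qed.

Lemma eq_section_integral f g : (forall y, K (hyperplane_chart u t y) ->
    f (hyperplane_chart u t y) = g (hyperplane_chart u t y)) ->
  section_integral f = section_integral g.
Proof.
move=> fg; apply: eq_Rintegral => y _; rewrite !patchE.
by case: ifPn => // /set_mem /fg.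
Qed.

Lemma section_integralD f g : bounded_on f -> bounded_on g ->
  section_integral (fun x => f x + g x) = section_integral f + section_integral g.
Proof.
move=> hf hg; rewrite /section_integral -RintegralD//; try exact: integrable_sec.
by apply: eq_Rintegral => y _; rewrite !patchE; case: ifPn => // _; rewrite addr0.
Qed.

Lemma section_integralZ c f : bounded_on f ->
  section_integral (fun x => c * f x) = c * section_integral f.
Proof.
move=> hf; rewrite /section_integral -RintegralZl//; try exact: integrable_sec.
by apply: eq_Rintegral => y _; rewrite !patchE; case: ifPn => // _; rewrite mulr0.
Qed.

Lemma section_integralB f g : bounded_on f -> bounded_on g ->
  section_integral (fun x => f x - g x) = section_integral f - section_integral g.
Proof.
move=> hf hg; rewrite /section_integral -RintegralB//; try exact: integrable_sec.
by apply: eq_Rintegral => y _; rewrite !patchE; case: ifPn => // _; rewrite subr0.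
Qed.

Lemma section_integral_le f C : bounded_on f -> (forall x, K x -> `|f x| <= C) ->
  `|section_integral f| <= C * section_integral (cst 1).
Proof.
move=> hf fC; rewrite -section_integralZ; last exact: bounded_on_cst.
rewrite /section_integral; apply: (le_trans (le_normr_Rintegral measurableT (integrable_sec hf))).
apply: le_Rintegral => //.
- by apply: (integrable_norm (integrable_sec hf)).
- by apply: integrable_sec; apply: bounded_onZ; exact: bounded_on_cst.
- move=> y _ /=; rewrite !patchE; case: ifPn => [/set_mem /fC|_]; first by rewrite mulr1.
  by rewrite normr0.
Qed.

Lemma measurable_hyperplane : measurable (hyperplane u t).
Proof.
rewrite (_ : hyperplane u t = (fun x => dot x u) @^-1` `[t, t]%classic).
  by apply: measurable_preim => //; exact: measurable_dot.
apply/seteqP; split => x; rewrite /hyperplane/= in_itv/=; first by move=> ->; rewrite lexx.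
by rewrite -eq_le eq_sym => /eqP.
Qed.

Let mKH : measurable (K `&` hyperplane u t).
Proof.
by apply: measurableI; [exact: convex_body_measurable|exact: measurable_hyperplane].
Qed.

Let restrictE (f : 'rV[R]_n.+1 -> R) y : (f \_ (K `&` hyperplane u t)) (hyperplane_chart u t y) =
  (f \_ K) (hyperplane_chart u t y).
Proof.
rewrite !patchE; suff -> : (hyperplane_chart u t y \in K `&` hyperplane u t) =
  (hyperplane_chart u t y \in K) by [].
apply/idP/idP; rewrite !inE; first by case.
by split => //; rewrite /hyperplane/= dot_chart_u.
Qed.

Lemma integrable_hyperplane f : bounded_on f ->
  (hyperplane_measure u t).-integrable (K `&` hyperplane u t) (EFin \o f).
Proof.
move=> hf; apply/(integrable_mkcond _ mKH); rewrite restrict_EFin.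
apply: (@integrable_pushforward _ _ _ _ _ _ (measurable_hyperplane_chart u t)) => //.
  apply/measurable_EFinP/(measurable_restrict _ mKH measurableT); apply: measurable_funTS.
  exact: hf.1.
rewrite preimage_setT; apply: eq_integrable (integrable_sec hf) => // y _ /=.
by rewrite restrictE.
Qed.

Lemma Rintegral_hyperplane f : bounded_on f ->
  \int[hyperplane_measure u t]_(x in K `&` hyperplane u t) f x = section_integral f.
Proof.
move=> hf; rewrite Rintegral_mkcond /Rintegral /section_integral /Rintegral; congr fine.
have mg : measurable_fun setT (EFin \o (f \_ (K `&` hyperplane u t))).
  apply/measurable_EFinP/(measurable_restrict _ mKH measurableT); apply: measurable_funTS.
  exact: hf.1.
rewrite (@integral_pushforward _ _ _ _ _ _ (measurable_hyperplane_chart u t)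
  (lebesgue_rV n) setT _ mg)//.
  by rewrite preimage_setT; apply: eq_integral => y _ /=; rewrite restrictE.
rewrite preimage_setT; apply: eq_integrable (integrable_sec hf) => // y _ /=.
by rewrite restrictE.
Qed.

End section_integral.
End bounded_on.

(** * The covariance form of a section *)

Section covariance.
Context {R : realType} {n : nat} (K : set 'rV[R]_n.+1) (hK : convex_body K).
Context (u : 'rV[R]_n.+1) (u1 : unit_sphere u) (t : R).

Definition section_centroid (v : 'rV[R]_n.+1) : R :=
  dot (hyperplane_centroid u t (K `&` hyperplane u t)) v.

Local Notation SI := (section_integral K u t).
Local Notation beta := section_centroid.

Let bd := bounded_on_dot hK.
Let bc := @bounded_on_cst R n K.
Let mKH : measurable (K `&` hyperplane u t).
Proof.
by apply: measurableI; [exact: convex_body_measurable|exact: measurable_hyperplane].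
Qed.

(** Free of division, the identity also covers a section of zero area: both sides then vanish, the
    right one by [section_integral_le]. *)
Lemma section_centroidE v : beta v * SI (cst 1) = SI (fun x => dot x v).
Proof.
have AE : fine (hyperplane_measure u t (K `&` hyperplane u t)) = SI (cst 1).
  rewrite -(Rintegral_hyperplane hK u1 t (bc 1)) /= Rintegral_cst ?mul1r//.
rewrite /beta /hyperplane_centroid dot_row_Rintegral//; last first.
  move=> i; apply: (integrable_hyperplane hK u1).
  by under eq_fun do rewrite -dot_delta; exact: bd.
rewrite (Rintegral_hyperplane hK u1 t (bd v)) AE.
have [A0|A0] := eqVneq (SI (cst 1)) 0.
  have [C hC] := (bd v).2; have := section_integral_le hK u1 t (bd v) hC.
  by rewrite A0 mulr0 normr_le0 => /eqP ->; rewrite mulr0.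
by rewrite mulrAC mulVf// mul1r.
Qed.

(** Only one factor is centred, which is how the form appears in the derivative; [section_covE]
    shows that this is already the unnormalized covariance. *)
Definition section_cov v e : R := SI (fun x => (dot x v - beta v) * dot x e).

Let bdb v : bounded_on K (fun x => dot x v - beta v).
Proof. by apply: bounded_onB => //; exact: bc. Qed.

Lemma section_covE v e : section_cov v e =
  SI (fun x => dot x v * dot x e) - beta v * beta e * SI (cst 1).
Proof.
rewrite -mulrA section_centroidE -section_integralZ// -section_integralB//; last 2 first.
- exact: bounded_onM.
- exact: bounded_onZ.
by apply: eq_section_integral => y _; rewrite mulrBl.
Qed.

Lemma section_cov_sym v e : section_cov v e = section_cov e v.
Proof.
rewrite !section_covE (mulrC (beta v)); congr (_ - _).
by apply: eq_section_integral => y _; rewrite mulrC.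
Qed.

Lemma section_covDr v e f : section_cov v (e + f) = section_cov v e + section_cov v f.
Proof.
rewrite /section_cov -section_integralD//; try exact: bounded_onM.
by apply: eq_section_integral => y _; rewrite dotDr mulrDr.
Qed.

Lemma section_covZr v c e : section_cov v (c *: e) = c * section_cov v e.
Proof.
rewrite /section_cov -section_integralZ//; try exact: bounded_onM.
by apply: eq_section_integral => y _; rewrite dotZr mulrCA.
Qed.

Lemma section_covDl v e f : section_cov (e + f) v = section_cov e v + section_cov f v.
Proof. by rewrite section_cov_sym section_covDr !(section_cov_sym v). Qed.

Lemma section_covZl v c e : section_cov (c *: e) v = c * section_cov e v.
Proof. by rewrite section_cov_sym section_covZr !(section_cov_sym v). Qed.

Lemma section_integral_centered v : SI (fun x => dot x v - beta v) = 0.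
Proof.
rewrite section_integralB//; last exact: bc.
rewrite -section_centroidE -section_integralZ//.
by apply/eqP; rewrite subr_eq0; apply/eqP/eq_section_integral => y _; rewrite /= mulr1.
Qed.

(** On the section [<x, u>] is the constant [t], and a centred function integrates to zero against
    it. *)
Lemma section_cov_normal v : section_cov v u = 0.
Proof.
rewrite /section_cov (eq_section_integral (g := fun x => t * (dot x v - beta v))).
  by rewrite section_integralZ// section_integral_centered mulr0.
by move=> y _; rewrite (dot_chart_u u1) mulrC.
Qed.

End covariance.

Section centroid_derivative.
Context {R : realType} {n : nat} (K : set 'rV[R]_n.+1) (hK : convex_body K).
Context (delta : R) (d0 : 0 < delta) (d1 : delta < 1).
Implicit Types u v e : 'rV[R]_n.+1.

Let t u := cut_level K delta u.
Let cov u := section_cov K u (t u).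

Lemma section_moment_cov u v : unit_sphere u ->
  section_moment K delta u v = cov u v v.
Proof.
move=> u1; rewrite /section_moment /cut_hyperplane -/(t u).
have bv := bounded_on_dot hK v.
have bc c : bounded_on K (cst c) by exact: bounded_on_cst.
rewrite -/(section_centroid K u (t u) v); set b := section_centroid _ _ _ _.
have bv2 : bounded_on K (fun x => dot x v ^+ 2) by exact: bounded_onM.
rewrite (Rintegral_hyperplane hK u1 (t u) (bounded_onB bv2 (bc (b ^+ 2)))).
rewrite /cov section_covE// section_integralB// -/b -expr2; congr (_ - _).
rewrite -section_integralZ//.
by apply: eq_section_integral => y _; rewrite /= mulr1.
Qed.

Lemma bounded_on_integrable f D : bounded_on K f -> measurable D -> D `<=` K ->
  (lebesgue_rV n.+1).-integrable D (EFin \o f).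
Proof.
move=> hf mD DK; have mK := convex_body_measurable hK.
apply: (integrableS mK) => //; apply/(integrable_mkcond _ mK); rewrite restrict_EFin.
by apply: tame_integrable => //; exact: tame_restrict.
Qed.

Let mcap u s : measurable (K `&` halfspace_ge u s).
Proof.
by apply: measurableI; [exact: convex_body_measurable|exact: measurable_halfspace_ge].
Qed.

Lemma dot_cap_centroid u e : dot (cap_centroid K delta u) e =
  (delta * vol K)^-1 * \int[lebesgue_rV n.+1]_(x in K `&` halfspace_ge u (t u)) dot x e.
Proof.
apply: (dot_row_Rintegral (phi := id)) => // i.
apply: bounded_on_integrable => //.
have := bounded_on_dot hK (delta_mx 0 i); congr (bounded_on K _).
by apply/funext => x; rewrite dot_delta.
Qed.

Lemma Rintegral_cap u s (f : 'rV[R]_n.+1 -> R) :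
  \int[lebesgue_rV n.+1]_(x in K `&` halfspace_ge u s) f x =
  \int[lebesgue_rV n.+1]_x ((s <= dot x u)%R%:R * (f \_ K) x).
Proof.
rewrite Rintegral_mkcond; apply: eq_Rintegral => x _; rewrite !patchE.
rewrite /halfspace_ge in_setI; case: (x \in K) => /=; last by rewrite mulr0.
suff -> : (x \in [set x0 | s <= dot x0 u]) = (s <= dot x u).
  by case: (_ <= _); rewrite ?mul1r ?mul0r.
by apply/idP/idP; rewrite inE.
Qed.

Lemma tame_step (s : R) (h : 'rV[R]_n.+1 -> R) f : bounded_on K f ->
  measurable_fun setT h -> tame (fun x => (s <= h x)%R%:R * (f \_ K) x).
Proof.
move=> hf mh; apply: tameM; [exact: tame_restrict|exact: measurable_step|].
by exists 1 => x _; case: (s <= h x); rewrite ?normr1 ?normr0.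
Qed.

(* The two half-spaces are nested, so the difference of their indicators has a sign. *)
Lemma nested_step_le (a b : R) (h : 'rV[R]_n.+1 -> R) f C :
  measurable_fun setT h -> bounded_on K f -> (forall x, K x -> `|f x| <= C) ->
  `|\int[lebesgue_rV n.+1]_x ((a <= h x)%R%:R * (f \_ K) x) -
    \int[lebesgue_rV n.+1]_x ((b <= h x)%R%:R * (f \_ K) x)| <=
  C * `|\int[lebesgue_rV n.+1]_x ((a <= h x)%R%:R * ((cst 1 : 'rV[R]_n.+1 -> R) \_ K) x) -
    \int[lebesgue_rV n.+1]_x ((b <= h x)%R%:R * ((cst 1 : 'rV[R]_n.+1 -> R) \_ K) x)|.
Proof.
move=> mh hf fC.
wlog ab : a b / a <= b.
  by move=> H; have [/H//|/ltW/H] := leP a b; rewrite distrC [X in _ <= _ * X]distrC.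
have bc1 : bounded_on K (cst 1) by exact: bounded_on_cst.
rewrite -!RintegralB//; try by apply: tame_integrable => //; exact: tame_step.
have intd g : bounded_on K g -> (lebesgue_rV n.+1).-integrable setT
    (EFin \o (fun x => (a <= h x)%R%:R * (g \_ K) x - (b <= h x)%R%:R * (g \_ K) x)).
  move=> hg.
  pose A x := (a <= h x)%R%:R * (g \_ K) x; pose B x := (b <= h x)%R%:R * (g \_ K) x.
  rewrite (_ : EFin \o _ = (EFin \o A) \- (EFin \o B))%E//.
  by apply: integrableB => //; apply: tame_integrable => //; exact: tame_step.
apply: (le_trans (le_normr_Rintegral measurableT (intd f hf))).
rewrite [X in _ <= C * X]ger0_norm; last first.
  apply: Rintegral_ge0 => x _; rewrite -mulrBl patchE; case: ifP => _; last by rewrite mulr0.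
  rewrite mulr1 subr_ge0 ler_nat; have [bh|//] := leP b (h x).
  by rewrite (le_trans ab bh).
rewrite -RintegralZl//; last exact: intd.
apply: le_Rintegral => //.
- exact: (integrable_norm (intd f hf)).
- exact: (integrableZl measurableT C (intd _ bc1)).
move=> x _ /=; rewrite -!mulrBl !patchE.
have : 0 <= (a <= h x)%R%:R - (b <= h x)%R%:R :> R.
  rewrite subr_ge0 ler_nat; have [bh|//] := leP b (h x).
  by rewrite (le_trans ab bh).
set w : R := _ - _ => w0; rewrite normrM (ger0_norm w0).
case: ifPn => [/set_mem Kx|_]; last by rewrite normr0 !mulr0.
by rewrite mulr1 mulrC ler_wpM2r// fC.
Qed.

End centroid_derivative.

(** * The derivative of the cap centroid *)

Section rotation.
Context {R : realType} {n : nat}.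
Implicit Types u v : 'rV[R]_n.

(* With h = tan (theta / 2), this is the rotation of u by theta towards v. *)
Definition rotate u v (h : R) : 'rV[R]_n :=
  ((1 - h ^+ 2) / (1 + h ^+ 2)) *: u + (2 * h / (1 + h ^+ 2)) *: v.

Lemma onepsq_neq0 (h : R) : 1 + h ^+ 2 != 0.
Proof. by rewrite gt_eqF// ltr_pwDl// sqr_ge0. Qed.

Lemma unit_rotate u v h : unit_sphere u -> unit_sphere v -> dot v u = 0 ->
  unit_sphere (rotate u v h).
Proof.
move=> /unit_sphereP u1 /unit_sphereP v1 vu; apply/unit_sphereP.
rewrite /rotate !dot_linE u1 v1 (dotC u v) vu; field; exact: onepsq_neq0.
Qed.

End rotation.

Section cap_centroid_derivative.
Context {R : realType} {n : nat} (K : set 'rV[R]_n.+1) (hK : convex_body K).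
Context (delta : R) (d0 : 0 < delta) (d1 : delta < 1).
Context (u v : 'rV[R]_n.+1) (u1 : unit_sphere u) (v1 : unit_sphere v) (vu : dot v u = 0).

Let t := cut_level K delta u.
Let SI := section_integral K u t.
Let beta := section_centroid K u t v.
(** The normal [u + e v] is left unnormalized because the wedge substitution is linear in it; a
    rotated [u] is a positive multiple of such a vector. *)
Let step (e s : R) (f : 'rV[R]_n.+1 -> R) : R := \int[lebesgue_rV n.+1]_x
   ((s <= dot x u + e * dot x v)%R%:R * (f \_ K) x).

Let mh e : measurable_fun setT (fun x : 'rV[R]_n.+1 => dot x u + e * dot x v).
Proof.
apply: measurable_funD; first exact: measurable_dot.
by apply: measurable_funM => //; exact: measurable_dot.
Qed.

Let step_derivative f (e_ : nat -> R) : continuous f -> bounded_on K f ->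
  (forall k, 0 < e_ k) -> e_ @ \oo --> (0 : R) ->
  (fun k => (e_ k)^-1 * (step (e_ k) (t + e_ k * beta) f - step 0 t f)) @ \oo -->
  SI (fun x => (dot x v - beta) * f x).
Proof.
move=> cf hf e0 ecvg.
have [p Kp pt] := cut_level_interior hK d0 d1 u1.
have tf := tame_restrict hK hf.
have := @wedge_derivative _ _ u v u1 vu t beta _ tf e_
  (ae_continuous_section hK u1 cf (ex_intro2 _ _ p Kp pt)) e0 ecvg.
have -> : SI (fun x => (dot x v - beta) * f x) = \int[lebesgue_rV n]_y
    ((dot (hyperplane_chart u t y) v - beta) * (f \_ K) (hyperplane_chart u t y)).
  apply: eq_Rintegral => y _; rewrite !patchE; case: ifP => // _.
  by rewrite mulr0.
apply: cvg_trans; apply: near_eq_cvg; apply: nearW => k.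
congr (_ * _); rewrite /step -RintegralB//.
- by apply: eq_Rintegral => x _; rewrite mul0r addr0 mulrBl.
- by apply: tame_integrable => //; apply: tame_step.
- by apply: tame_integrable => //; apply: tame_step.
Qed.

(* The half-space through the centroid has the right volume up to o(e), and it
   is nested with the half-space which has exactly the right volume. *)
Let cut_derivative f (e_ s_ : nat -> R) : continuous f -> bounded_on K f ->
  (forall k, 0 < e_ k) -> e_ @ \oo --> (0 : R) ->
  (forall k, step (e_ k) (s_ k) (cst 1) = step 0 t (cst 1)) ->
  (fun k => (e_ k)^-1 * (step (e_ k) (s_ k) f - step 0 t f)) @ \oo -->
  SI (fun x => (dot x v - beta) * f x).
Proof.
move=> cf hf e0 ecvg hs.
have c1 : continuous (cst 1 : 'rV[R]_n.+1 -> R).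
  by move=> x; exact: (@cvg_cst _ _ _ (nbhs x) (nbhs_filter x)).
have b1 : bounded_on K (cst 1) by exact: bounded_on_cst.
have [C fC] := hf.2.
have D1 := step_derivative c1 b1 e0 ecvg.
have E1 : SI (fun x => (dot x v - beta) * cst 1 x) = 0.
  rewrite -(section_integral_centered hK u1 t v).
  by apply: eq_section_integral => y _; rewrite /= mulr1.
rewrite E1 in D1.
have Df := step_derivative cf hf e0 ecvg.
pose r k := (e_ k)^-1 * (step (e_ k) (s_ k) f - step (e_ k) (t + e_ k * beta) f).
pose d k := (e_ k)^-1 * (step (e_ k) (t + e_ k * beta) (cst 1) - step 0 t (cst 1)).
have bcvg : (fun k => C * `|d k|) @ \oo --> (0 : R).
  suff : (fun k => C * `|d k|) @ \oo --> C * `|0 : R| by rewrite normr0 mulr0.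
  by apply: cvgMl_tmp; apply: cvg_norm.
have rb k : `|r k| <= C * `|d k|.
  rewrite /r /d !normrM mulrCA ler_pM2l ?normr_gt0 ?invr_neq0 ?gt_eqF//.
  by rewrite -(hs k) [X in _ <= _ * X]distrC; exact: nested_step_le.
have rcvg : r @ \oo --> (0 : R).
  apply: (@squeeze_cvgr _ _ _ _ (fun k => - (C * `|d k|)) (fun k => C * `|d k|)) => //.
    by apply: nearW => k; rewrite -ler_norml.
  by rewrite -oppr0; exact: cvgN.
suff : (fun k => (e_ k)^-1 * (step (e_ k) (t + e_ k * beta) f - step 0 t f) + r k) @ \oo -->
    SI (fun x => (dot x v - beta) * f x) + 0.
  rewrite addr0; apply: cvg_trans; apply: near_eq_cvg; apply: nearW => k; rewrite /r; ring.
exact: cvgD.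
Qed.

(** The parameter is the tangent of the half angle, so the angle is [2 h] to first order: hence the
    factor 2 in the limit. *)
Lemma cap_centroid_derivative e (h_ : nat -> R) : (forall k, 0 < h_ k < 1) ->
  h_ @ \oo --> (0 : R) ->
  (fun k => (h_ k)^-1 * (dot (cap_centroid K delta (rotate u v (h_ k))) e -
     dot (cap_centroid K delta u) e)) @ \oo -->
  (delta * vol K)^-1 * section_cov K u t v e * 2.
Proof.
move=> h01 hcvg.
have h0 k : 0 < h_ k by have /andP[] := h01 k.
have h2 k : 0 < 1 - h_ k ^+ 2.
  by have /andP[a b] := h01 k; rewrite subr_gt0 expr_lt1// ltW.
(* [c k] and [e_ k] are the cosine and the tangent of the angle. [h_ k < 1] keeps the cosine
   positive, so dividing by it preserves the inequality that defines the half-space. *)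
pose c k := (1 - h_ k ^+ 2) / (1 + h_ k ^+ 2).
have c0 k : 0 < c k by rewrite divr_gt0// ltr_pwDl// sqr_ge0.
pose e_ k := 2 * h_ k / (1 - h_ k ^+ 2).
have e0 k : 0 < e_ k by rewrite divr_gt0// mulr_gt0.
have h2cvg : (fun k => 1 - h_ k ^+ 2) @ \oo --> (1 : R).
  suff : (fun k => 1 - h_ k * h_ k) @ \oo --> (1 - 0 * 0 : R) by rewrite mulr0 subr0.
  by apply: cvgB; [exact: cvg_cst|exact: cvgM].
have rcvg : (fun k => 2 / (1 - h_ k ^+ 2)) @ \oo --> (2 : R).
  suff : (fun k => 2 / (1 - h_ k ^+ 2)) @ \oo --> (2 / 1 : R) by rewrite divr1.
  by apply: cvgMl_tmp; apply: cvgV.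
have ecvg : e_ @ \oo --> (0 : R).
  suff : (fun k => h_ k * (2 / (1 - h_ k ^+ 2))) @ \oo --> (0 * 2 : R).
    rewrite mul0r; apply: cvg_trans; apply: near_eq_cvg; apply: nearW => k; rewrite /e_; ring.
  exact: cvgM.
pose s_ k := cut_level K delta (rotate u v (h_ k)) / c k.
have rotE k x : dot x (rotate u v (h_ k)) = c k * (dot x u + e_ k * dot x v).
  rewrite /rotate !dot_linE /c /e_; field.
  by rewrite onepsq_neq0 gt_eqF.
have capE k f : \int[lebesgue_rV n.+1]_(x in K `&` halfspace_ge (rotate u v (h_ k))
    (cut_level K delta (rotate u v (h_ k)))) f x = step (e_ k) (s_ k) f.
  rewrite Rintegral_cap; apply: eq_Rintegral => x _; congr (_%:R * _).
  by rewrite rotE /s_ ler_pdivrMr// mulrC.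
have cap0 f : \int[lebesgue_rV n.+1]_(x in K `&` halfspace_ge u t) f x = step 0 t f.
  by rewrite Rintegral_cap; apply: eq_Rintegral => x _; rewrite mul0r addr0.
have volE w : unit_sphere w -> \int[lebesgue_rV n.+1]_(x in K `&` halfspace_ge w
    (cut_level K delta w)) (cst 1 x) = delta * vol K.
  move=> w1; rewrite Rintegral_cst ?mul1r; first exact: cut_levelP.
  by apply: measurableI; [exact: convex_body_measurable|exact: measurable_halfspace_ge].
have hs k : step (e_ k) (s_ k) (cst 1) = step 0 t (cst 1).
  rewrite -capE -cap0 volE; last exact: unit_rotate.
  by rewrite volE.
have D := cut_derivative (@dot_continuous R _ e) (bounded_on_dot hK e) e0 ecvg hs.
suff : (fun k => (delta * vol K)^-1 * ((e_ k)^-1 * (step (e_ k) (s_ k) (dot^~ e) -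
    step 0 t (dot^~ e))) * (2 / (1 - h_ k ^+ 2))) @ \oo -->
    (delta * vol K)^-1 * section_cov K u t v e * 2.
  apply: cvg_trans; apply: near_eq_cvg; apply: nearW => k.
  rewrite !dot_cap_centroid// capE cap0 /e_; field.
  by rewrite !gt_eqF// (convex_body_vol hK).2.
by apply: cvgM rcvg; apply: cvgMl_tmp.
Qed.

End cap_centroid_derivative.

(** * Isotropic sections *)

Section rotation_theory.
Context {R : realType} {n : nat}.
Implicit Types u v w : 'rV[R]_n.

Lemma rotate0 u v : rotate u v 0 = u.
Proof. by rewrite /rotate expr0n subr0 addr0 divr1 mulr0 mul0r scale0r scale1r addr0. Qed.

Lemma rotateN u v h : rotate u (- v) h = rotate u v (- h).
Proof.
by rewrite /rotate sqrrN scalerN -scaleNr; congr (_ + _ *: _); field; exact: onepsq_neq0.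
Qed.

(** [rotate v (- u) s] is the unit tangent of the great circle at [rotate u v s]. *)
Lemma rotate_orth u v s : unit_sphere u -> unit_sphere v -> dot v u = 0 ->
  dot (rotate v (- u) s) (rotate u v s) = 0.
Proof.
move=> /unit_sphereP u1 /unit_sphereP v1 vu.
rewrite /rotate !dot_linE u1 v1 (dotC u v) vu; field; exact: onepsq_neq0.
Qed.

(* Addition formula for the tangent of the half angle. *)
Lemma rotate_rotate u v s k : 1 + s * (s + k) != 0 ->
  rotate (rotate u v s) (rotate v (- u) s) (k / (1 + s * (s + k))) = rotate u v (s + k).
Proof.
move=> q0.
have e1 := onepsq_neq0 s; have e2 := onepsq_neq0 (s + k).
have e3 : (1 + s * (s + k)) ^+ 2 + k ^+ 2 != 0.
  rewrite (_ : _ + _ = (1 + s ^+ 2) * (1 + (s + k) ^+ 2)); last by ring.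
  by rewrite mulf_neq0.
apply/rowP => i; rewrite /rotate !mxE; field.
by apply/and4P; split.
Qed.

(** With [a] the cosine and [b] the sine of the angle from [u] to [w], the tangent of the half angle
    is [b / (1 + a)], undefined only at the antipode. *)
Lemma rotate_surj u w : unit_sphere u -> unit_sphere w -> w <> - u -> w <> u ->
  exists v s, [/\ unit_sphere v, dot v u = 0 & w = rotate u v s].
Proof.
move=> u1 w1 wNu wu.
have uu := (unit_sphereP u).1 u1; have ww := (unit_sphereP w).1 w1.
set a := dot w u.
pose z := w - a *: u.
have zz : dot z z = 1 - a ^+ 2.
  by rewrite /z !dot_linE uu ww (dotC u w) -/a; ring.
have z0 : 0 < dot z z.
  rewrite lt_neqAle dot_ge0 andbT eq_sym; apply/eqP => zz0.
  have zE : w = a *: u.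
    by apply/eqP; rewrite -subr_eq0 -/z; apply/eqP/dot_eq0; rewrite zz0.
  have : (1 - a) * (1 + a) = 0 by rewrite -zz0 zz; ring.
  move=> /eqP; rewrite mulf_eq0 => /orP[/eqP h|/eqP h].
    by apply: wu; rewrite zE (_ : a = 1) ?scale1r//; lra.
  by apply: wNu; rewrite zE (_ : a = -1) ?scaleN1r//; lra.
pose b := Num.sqrt (dot z z).
have b0 : 0 < b by rewrite sqrtr_gt0.
have bb : b ^+ 2 = 1 - a ^+ 2 by rewrite sqr_sqrtr ?ltW.
have a1 : 1 + a != 0.
  apply/eqP => h; have aE : a = -1 by lra.
  by move: z0; rewrite zz aE sqrrN expr1n subrr ltxx.
exists (b^-1 *: z), (b / (1 + a)); split.
- by apply/unit_sphereP; rewrite dotZl dotZr zz -bb; field; exact: lt0r_neq0.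
- by rewrite dotZl /z dotBl dotZl uu -/a mulr1 subrr mulr0.
have e1 : (1 + a) ^+ 2 + b ^+ 2 = 2 * (1 + a) by rewrite bb; ring.
have -> : w = a *: u + b *: (b^-1 *: z).
  by rewrite scalerA mulfV ?gt_eqF// scale1r /z addrC subrK.
have e2 : 1 + (b / (1 + a)) ^+ 2 = 2 / (1 + a).
  by rewrite expr_div_n bb; field.
rewrite /rotate e2; congr (_ *: _ + _ *: _); last by field.
by rewrite expr_div_n bb; field.
Qed.

End rotation_theory.

Section isotropic.
Context {R : realType} {n : nat} (K : set 'rV[R]_n.+1) (hK : convex_body K).
Context (delta : R) (d0 : 0 < delta) (d1 : delta < 1) (r : R).
Hypothesis moment : forall u v : 'rV[R]_n.+1, unit_sphere u -> unit_sphere v ->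
  dot v u = 0 -> section_moment K delta u v = delta * vol K * r.
Implicit Types u v w e : 'rV[R]_n.+1.

Let m := delta * vol K * r.
Let cov u := section_cov K u (cut_level K delta u).

Let cov_diag u w : unit_sphere u -> dot w u = 0 -> cov u w w = m * dot w w.
Proof.
move=> u1 wu; have [w0|w0] := leP (dot w w) 0.
  rewrite (dot_eq0 w0) dot0l mulr0 -(scale0r 0) /cov section_covZl// mul0r//.
pose b := Num.sqrt (dot w w).
have b0 : 0 < b by rewrite sqrtr_gt0.
have bb : b ^+ 2 = dot w w by rewrite sqr_sqrtr ?ltW.
have -> : w = b *: (b^-1 *: w) by rewrite scalerA mulfV ?gt_eqF// scale1r.
rewrite /cov section_covZl// section_covZr// -/(cov u).
rewrite -[cov u _ _](section_moment_cov hK delta (b^-1 *: w) u1) moment//.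
- by rewrite !dotZl !dotZr -bb -/m; field; exact: lt0r_neq0.
- by apply/unit_sphereP; rewrite dotZl dotZr -bb; field; exact: lt0r_neq0.
- by rewrite dotZl wu mulr0.
Qed.

(** The part of [e] along [u] contributes nothing on either side; polarization is applied to [v] and
    the remaining part [f]. *)
Lemma isotropic_cov u v e : unit_sphere u -> unit_sphere v -> dot v u = 0 ->
  section_cov K u (cut_level K delta u) v e = m * dot v e.
Proof.
move=> u1 v1 vu; rewrite -/(cov u).
have uu := (unit_sphereP u).1 u1.
have [f fu eE] : exists2 f, dot f u = 0 & e = f + dot e u *: u.
  by exists (e - dot e u *: u); rewrite ?subrK// dotBl dotZl uu mulr1 subrr.
have vf : dot v e = dot v f by rewrite eE dotDr dotZr vu mulr0 addr0.
rewrite vf {1}eE /cov section_covDr// section_covZr// section_cov_normal// mulr0 addr0.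
have vfu : dot (v + f) u = 0 by rewrite dotDl vu fu addr0.
have H1 := cov_diag u1 vfu; have H2 := cov_diag u1 vu; have H3 := cov_diag u1 fu.
rewrite /cov in H1 H2 H3.
rewrite section_covDl// !section_covDr// in H1.
rewrite (section_cov_sym hK u1 _ f v) !dotDl !dotDr (dotC f v) in H1.
lra.
Qed.

Let Y w := cap_centroid K delta w - r *: w.

Let Y_seq u v e (h_ : nat -> R) : unit_sphere u -> unit_sphere v -> dot v u = 0 ->
  (forall k, 0 < h_ k < 1) -> h_ @ \oo --> (0 : R) ->
  (fun k => (h_ k)^-1 * (dot (Y (rotate u v (h_ k))) e - dot (Y u) e)) @ \oo --> (0 : R).
Proof.
move=> u1 v1 vu h01 hcvg.
have D := cap_centroid_derivative hK d0 d1 u1 v1 vu h01 hcvg (e := e).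
have v0 := (convex_body_vol hK).2.
have LE : (delta * vol K)^-1 * section_cov K u (cut_level K delta u) v e * 2 = r * (2 * dot v e).
  by rewrite isotropic_cov// /m; field; rewrite !gt_eqF.
rewrite LE in D.
(* The difference quotient of [<rotate u v h, e>] in closed form. *)
pose q k := (2 / (1 + h_ k * h_ k)) * (dot v e - h_ k * dot u e).
have qcvg : q @ \oo --> (2 * dot v e : R).
  suff : q @ \oo --> (2 / (1 + 0 * 0)) * (dot v e - 0 * dot u e).
    by rewrite !mul0r addr0 subr0 divr1.
  apply: cvgM.
    apply: cvgMl_tmp; apply: cvgV; first by rewrite mul0r addr0.
    by apply: cvgD; [exact: cvg_cst|exact: cvgM].
  by apply: cvgB; [exact: cvg_cst|exact: cvgMr_tmp].
suff : (fun k => (h_ k)^-1 * (dot (cap_centroid K delta (rotate u v (h_ k))) e -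
     dot (cap_centroid K delta u) e) - r * q k) @ \oo --> r * (2 * dot v e) - r * (2 * dot v e).
  rewrite subrr; apply: cvg_trans; apply: near_eq_cvg; apply: nearW => k.
  rewrite /Y !dotBl !dotZl {3}/rotate !dot_linE /q.
  have h0 : h_ k != 0 by have /andP[? _] := h01 k; rewrite gt_eqF.
  by field; rewrite h0 onepsq_neq0.
by apply: cvgB => //; exact: cvgMl_tmp.
Qed.

Let Y_right u v e (eps : R) : unit_sphere u -> unit_sphere v -> dot v u = 0 -> 0 < eps ->
  exists2 d : R, 0 < d & forall h, 0 < h -> h < d ->
    `|dot (Y (rotate u v h)) e - dot (Y u) e| <= eps * h.
Proof.
move=> u1 v1 vu eps0.
pose F h := h^-1 * (dot (Y (rotate u v h)) e - dot (Y u) e).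
have : F h @[h --> 0^'+] --> (0 : R).
  apply/cvg_at_rightP => h_ [h0 hcvg].
  (* Truncation brings the steps below 1 and alters only finitely many of them. *)
  pose h' k := Num.min (h_ k) 2^-1.
  have h'01 k : 0 < h' k < 1.
    by rewrite /h' lt_min gt_min h0 invr_gt0 ltr0n/= invf_lt1// ltr1n orbT.
  have nearh : \forall k \near \oo, h' k = h_ k.
    have : \forall k \near \oo, h_ k < 2^-1.
      by apply: (cvgr_lt (0 : R)) => //; rewrite invr_gt0.
    by apply: filterS => k hk; rewrite /h' min_l// ltW.
  have h'cvg : h' @ \oo --> (0 : R).
    apply: cvg_trans hcvg; apply: near_eq_cvg.
    by apply: filterS nearh => k ->.
  have := Y_seq e u1 v1 vu h'01 h'cvg; apply: cvg_trans; apply: near_eq_cvg.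
  by apply: filterS nearh => k ->.
move=> /cvgrPdist_le /(_ eps eps0) [d /= d0' hd].
exists d => // h hp hlt; have := hd h; rewrite /= !sub0r !normrN (gtr0_norm hp).
move=> /(_ hlt hp); rewrite /F normrM normfV (gtr0_norm hp) mulrC ler_pdivrMr//.
Qed.

(** A negative parameter is a positive rotation towards [- v]. *)
Let Y_both u v e (eps : R) : unit_sphere u -> unit_sphere v -> dot v u = 0 -> 0 < eps ->
  exists2 d : R, 0 < d & forall h, `|h| < d ->
    `|dot (Y (rotate u v h)) e - dot (Y u) e| <= eps * `|h|.
Proof.
move=> u1 v1 vu eps0.
have v1' : unit_sphere (- v).
  by apply/unit_sphereP; rewrite dotNl dotNr opprK; exact/unit_sphereP.
have vu' : dot (- v) u = 0 by rewrite dotNl vu oppr0.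
have [da da0 Ha] := Y_right e u1 v1 vu eps0.
have [db db0 Hb] := Y_right e u1 v1' vu' eps0.
exists (Num.min da db); first by rewrite lt_min da0.
move=> h; rewrite lt_min => /andP[hda hdb].
have [h0|h0|->] := ltgtP h 0.
- have := Hb (- h); rewrite oppr_gt0 rotateN opprK (ltr0_norm h0); apply => //.
  by rewrite -(ltr0_norm h0).
- by rewrite (gtr0_norm h0); apply: Ha => //; rewrite -(gtr0_norm h0).
- by rewrite rotate0 subrr normr0 mulr0.
Qed.

(** By the addition formula a further rotation at parameter [s] is a rotation of the moved frame, so
    the estimate at parameter [0] gives a zero derivative at every [s]. *)
Let Y_rotate u v s : unit_sphere u -> unit_sphere v -> dot v u = 0 ->
  Y (rotate u v s) = Y u.
Proof.
move=> u1 v1 vu.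
suff H e : dot (Y (rotate u v s)) e = dot (Y u) e.
  by apply/rowP => i; rewrite -!dot_delta H.
pose Z s := dot (Y (rotate u v s)) e.
rewrite -{2}(rotate0 u v) -/(Z 0) -/(Z s).
apply: is_derive_0_is_cst => {}s.
have u1' := unit_rotate s u1 v1 vu.
have Nu1 : unit_sphere (- u).
  by apply/unit_sphereP; rewrite dotNl dotNr opprK; exact/unit_sphereP.
have v1' : unit_sphere (rotate v (- u) s).
  by apply: unit_rotate => //; rewrite dotNl dotC vu oppr0.
have vu' := rotate_orth s u1 v1 vu.
have cvgZ0 : (fun k => k^-1 *: (Z (k *: 1 + s) - Z s)) @ 0^' --> (0 : R).
  apply/cvgrPdist_le => eps eps0.
  have eps2 : 0 < eps / 2 by rewrite divr_gt0.
  have [d dpos Hd] := Y_both e u1' v1' vu' eps2.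
  near=> k.
  have k0 : k != 0 by near: k; exact: nbhs_dnbhs_neq.
  (* [|k| < 1] keeps the denominator [1 + s (s + k)] above one half, so the moved parameter is at
     most [2 |k|]; the halves in [d / 2] and [eps / 2] absorb this 2. *)
  have kd : `|k| < Num.min 1 (d / 2).
    near: k; apply: dnbhs0_lt; rewrite lt_min ltr01 divr_gt0//.
  move: kd; rewrite lt_min => /andP[k1 kd].
  have q2 : 2^-1 <= 1 + s * (s + k).
    have : k ^+ 2 <= 1 by rewrite -real_normK ?num_real// expr_le1// ltW.
    nra.
  have q0 : 0 < 1 + s * (s + k) by apply: lt_le_trans q2; rewrite invr_gt0.
  have hk : `|k / (1 + s * (s + k))| <= 2 * `|k|.
    rewrite normrM normfV (gtr0_norm q0) ler_pdivrMr//.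
    have := normr_ge0 k; nra.
  have := Hd (k / (1 + s * (s + k))); rewrite rotate_rotate ?gt_eqF//.
  move=> H; rewrite sub0r normrN /GRing.scale/= mulr1 (addrC k s).
  rewrite normrM normfV ler_pdivrMl ?normr_gt0//; apply: (le_trans (H _)).
    by apply: (le_lt_trans hk); lra.
  by move: hk; set x := `|_ / _|; have := normr_ge0 k; nra.
split; first by apply/cvg_ex; exists 0.
exact: cvg_lim.
Unshelve. all: by end_near. Qed.

Lemma isotropic_centroid u w : (0 < n)%N -> unit_sphere u -> unit_sphere w ->
  cap_centroid K delta w - r *: w = cap_centroid K delta u - r *: u.
Proof.
move=> n0 u1 w1; rewrite -/(Y w) -/(Y u).
have gen a b : unit_sphere a -> unit_sphere b -> b <> - a -> Y b = Y a.
  move=> a1 b1 bNa; have [->//|/eqP ba] := eqVneq b a.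
  have [v [s [v1 va ->]]] := rotate_surj a1 b1 bNa ba.
  exact: Y_rotate.
have [wu|/eqP wu] := eqVneq w (- u); last exact: gen.
(* The half-angle parametrization misses [- u], which is reached in two moves through a unit vector
   [v] orthogonal to [u]. *)
pose y : 'rV[R]_n := delta_mx 0 (Ordinal n0).
have yy : dot y y = 1 by rewrite dot_delta mxE !eqxx.
pose v := hyperplane_chart u 0 y.
have v1 : unit_sphere v by apply/unit_sphereP; rewrite dot_chart// mul0r add0r.
have vu : dot v u = 0 by rewrite dot_chart_u.
have uu := (unit_sphereP u).1 u1.
rewrite wu -(gen u v)//; last first.
  by move=> vNu; have := vu; rewrite vNu dotNl uu; lra.
apply: gen => //; first by rewrite -wu.
move=> uv; have := vu; rewrite (_ : v = u); first by rewrite uu; lra.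
by apply: oppr_inj; rewrite -uv.
Qed.

End isotropic.

(** * Balls and metronoids *)

Section extremal.
Context {R : realType} {n : nat} (K : set 'rV[R]_n.+1) (hK : convex_body K).
Context (delta : R) (d0 : 0 < delta) (d1 : delta < 1).

(** Bathtub principle: the integrand [<x, u> - t] is nonnegative on the half-space of [u] and
    negative off it, and subtracting [t] costs both caps the same amount, as their volumes agree. *)
Lemma cap_centroid_extremal (u w : 'rV[R]_n.+1) : unit_sphere u -> unit_sphere w ->
  dot (cap_centroid K delta w) u <= dot (cap_centroid K delta u) u.
Proof.
move=> u1 w1; have v0 := (convex_body_vol hK).2.
rewrite !dot_cap_centroid// ler_pM2l ?invr_gt0 ?mulr_gt0//.
set t := cut_level K delta u; set s := cut_level K delta w.
have mcap v l : measurable (K `&` halfspace_ge v l).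
  by apply: measurableI; [exact: convex_body_measurable|exact: measurable_halfspace_ge].
have bu := bounded_on_dot hK u.
have bt : bounded_on K (cst t) by exact: bounded_on_cst.
have but := bounded_onB bu bt.
have split v : unit_sphere v ->
    \int[lebesgue_rV n.+1]_(x in K `&` halfspace_ge v (cut_level K delta v)) (dot x u - t) =
    \int[lebesgue_rV n.+1]_(x in K `&` halfspace_ge v (cut_level K delta v)) dot x u -
    t * (delta * vol K).
  move=> v1; rewrite RintegralB//; try by apply: (bounded_on_integrable hK).
  by rewrite Rintegral_cst// -/(vol _) (cut_levelP hK d0 d1 v1).
suff : \int[lebesgue_rV n.+1]_(x in K `&` halfspace_ge w s) (dot x u - t) <=
    \int[lebesgue_rV n.+1]_(x in K `&` halfspace_ge u t) (dot x u - t).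
  by rewrite !split// lerD2r.
rewrite !Rintegral_cap; apply: le_Rintegral => //.
- by apply: tame_integrable => //; apply: tame_step => //; exact: measurable_dot.
- by apply: tame_integrable => //; apply: tame_step => //; exact: measurable_dot.
move=> x _; rewrite patchE; case: ifP => _; last by rewrite !mulr0.
have [h|h] := leP t (dot x u); have [h'|h'] := leP s (dot x w);
  rewrite /= ?mul1r ?mul0r//; lra.
Qed.

End extremal.

Section balls.
Context {R : realType} {n : nat}.
Implicit Types (c x : 'rV[R]_n.+1) (r : R).

Lemma interior_ray (A : set 'rV[R]_n.+1) x d : A° x -> exists2 k : R, 0 < k & A (x + k *: d).
Proof.
move=> /nbhs_rVP[e e0 eA]; have d1 : 0 < 1 + `|d| by rewrite ltr_pwDl.
exists (e / (1 + `|d|)); first exact: divr_gt0.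
apply: eA => i; rewrite !mxE opprD addNKr normrN normrM.
have di : `|d 0 i| <= `|d| by have /normr_rVP := lexx `|d|; apply.
rewrite (gtr0_norm (divr_gt0 e0 d1)) mulrAC ltr_pdivrMr// ltr_pM2l//.
by apply: (le_lt_trans di); rewrite ltrDr.
Qed.

Lemma interior_eball c r : 0 < r -> (eball c r)° = [set x | dot (x - c) (x - c) < r ^+ 2].
Proof.
move=> r0; apply/seteqP; split => [x xi|x xr].
  have := interior_subset xi => /(eballP _ _ (ltW r0)) xb /=.
  rewrite lt_neqAle xb andbT; apply/eqP => xE.
  have [k k0] := interior_ray (x - c) xi.
  move=> /(eballP _ _ (ltW r0)); rewrite addrAC.
  rewrite -{1 3}[x - c]scale1r -scalerDl dotZl dotZr xE.
  have := exprn_gt0 2 r0; nra.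
have oB : open [set x | dot (x - c) (x - c) < r ^+ 2].
  rewrite (_ : [set _ | _] = (fun y => dot (y - c) (y - c)) @^-1` [set z | z < r ^+ 2])//.
  by apply: open_comp => [y _|]; [exact: sqdist_continuous|exact: open_lt].
have : nbhs x [set x | dot (x - c) (x - c) < r ^+ 2] by exact: open_nbhs_nbhs.
apply: (@filterS _ (nbhs x) (nbhs_filter _)) => y /= yr.
by apply/eballP; rewrite ltW.
Qed.

Lemma bdry_eball c r : 0 < r -> bdry (eball c r) = [set x | dot (x - c) (x - c) = r ^+ 2].
Proof.
move=> r0; rewrite /bdry -(closure_id _).1; last exact: closed_eball (ltW r0).
rewrite interior_eball//; apply/seteqP; split => [x [/(eballP _ _ (ltW r0)) h1 /negP h2]|x /= xE].
  by apply/eqP; rewrite eq_le h1 leNgt.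
by split; [apply/(eballP _ _ (ltW r0)); rewrite xE|rewrite xE ltxx].
Qed.

Lemma convex_body_eball c r : 0 < r -> convex_body (eball c r).
Proof.
move=> r0; have r0' := ltW r0; split.
- apply: bounded_closed_compact; last exact: closed_eball.
  exists (r + `|c|); split => [|M hM x /(eballP _ _ r0') xr]; first exact: num_real.
  rewrite /= -[x](subrK c).
  rewrite (le_trans (ler_normD _ _))// (le_trans _ (ltW hM))// lerD2r.
  apply/normr_rVP => // i; rewrite -ler_sqr ?nnegrE// real_normK ?num_real//.
  exact: le_trans (le_sqr_coord _ _) xr.
- apply/convex_setP => x y l /(eballP _ _ r0') xr /(eballP _ _ r0') yr l0 l1.
  apply/(eballP _ _ r0').
  have -> : l *: x + (1 - l) *: y - c = l *: (x - c) + (1 - l) *: (y - c).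
    by rewrite !scalerBr addrACA -opprD -scalerDl subrKC scale1r.
  have := dot_ge0 ((x - c) - (y - c)).
  move: xr yr; set a := x - c; set b := y - c; move: a b => a b.
  rewrite !dotDl !dotDr !dotZl !dotZr dotNl dotNr dotNl dotNr (dotC b a) => xr yr h.
  have : l * (1 - l) >= 0 by rewrite mulr_ge0// subr_ge0.
  nra.
- by exists c; rewrite interior_eball//= subrr dot0l exprn_gt0.
Qed.

(** The farthest point of [M] from [c] lies on the boundary, so [M] is inside the ball; conversely
    the sphere lies in the closed set [M], and convexity fills in its diameters. *)
Lemma bdry_eball_inj c r (M : set 'rV[R]_n.+1) : 0 < r -> convex_body M ->
  bdry M = bdry (eball c r) -> M = eball c r.
Proof.
move=> r0 [cM /convex_setP convM _] MB; rewrite bdry_eball// in MB.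
have r0' := ltW r0.
have clM : closed M by apply: compact_closed => //; exact: norm_hausdorff.
have bM x : M x -> dot (x - c) (x - c) <= r ^+ 2.
  move=> Mx; rewrite leNgt; apply/negP => xr.
  pose D (y : 'rV[R]_n.+1) := dot (y - c) (y - c).
  (* a point of M farthest from c lies on the boundary *)
  have [||p /set_mem Mp pmax] := @compact_EVT_max _ R D M _ cM.
  - by exists x.
  - by apply: continuous_subspaceT => y; exact: sqdist_continuous.
  have Dxp := pmax x (mem_set Mx).
  have p0 : 0 < D p by apply: lt_le_trans Dxp; apply: lt_trans xr; exact: exprn_gt0.
  have : bdry M p.
    rewrite /bdry -(closure_id _).1//; split => // pi.
    have [k k0 Mk] := interior_ray (p - c) pi.
    have := pmax _ (mem_set Mk); rewrite /D addrAC.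
    rewrite -{1 3}[p - c]scale1r -scalerDl dotZl dotZr -/(D p).
    nra.
  by rewrite MB /= -/(D p) => pr; move: Dxp; rewrite leNgt pr xr.
have sM x : dot (x - c) (x - c) = r ^+ 2 -> M x.
  move=> xr; have : bdry M x by rewrite MB.
  by rewrite /bdry -(closure_id _).1// => -[].
apply/seteqP; split => [x Mx|x /(eballP _ _ r0') xr]; first exact/eballP/bM.
have [e [rho [e1 rho0 xE]]] : exists e rho, [/\ dot e e = 1, 0 <= rho & x - c = rho *: e].
  have [x0|x0] := leP (dot (x - c) (x - c)) 0.
    exists (delta_mx 0 0), 0; rewrite dot_delta mxE !eqxx; split => //.
    by rewrite scale0r; exact: dot_eq0.
  pose rho := Num.sqrt (dot (x - c) (x - c)).
  have rho0 : 0 < rho by rewrite sqrtr_gt0.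
  have rr : rho ^+ 2 = dot (x - c) (x - c) by rewrite sqr_sqrtr ?ltW.
  exists (rho^-1 *: (x - c)), rho; split; last 2 first.
  - exact: ltW.
  - by rewrite scalerA mulfV ?gt_eqF// scale1r.
  by rewrite dotZl dotZr -rr; field; exact: lt0r_neq0.
have rhor : rho <= r.
  by move: xr; rewrite xE dotZl dotZr e1 mulr1 -expr2 ler_sqr.
(* [x] lies on the diameter with endpoints [c + r e] and [c - r e]. *)
have -> : x = ((1 + rho / r) / 2) *: (c + r *: e) + (1 - (1 + rho / r) / 2) *: (c - r *: e).
  rewrite !scalerDr addrACA -scalerDl subrKC scale1r scalerN -scaleNr !scalerA -scalerDl.
  rewrite -[LHS](subrKC c) xE; congr (_ + _ *: _); field; exact: lt0r_neq0.
apply: convM; [apply: sM|apply: sM| |].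
- by rewrite addrC addKr dotZl dotZr e1 mulr1.
- by rewrite addrC addKr dotNl dotNr opprK dotZl dotZr e1 mulr1.
- by rewrite divr_ge0// addr_ge0// divr_ge0.
- have : rho / r <= 1 by rewrite ler_pdivrMr// mul1r.
  lra.
Qed.

End balls.

Section metronoids.
Context {R : realType} {n : nat} (K : set 'rV[R]_n.+1).
Context (delta : R).
Implicit Types (c u : 'rV[R]_n.+1) (r : R).

(** The ball shows that a convex body with the prescribed boundary exists, and [bdry_eball_inj] that
    [get] can return no other. *)
Lemma metronoid_ball c r : 0 < r ->
  (forall u, unit_sphere u -> cap_centroid K delta u = c + r *: u) ->
  metronoid K delta = eball c r.
Proof.
move=> r0 X; pose P := [set M | convex_body M /\ bdry M = cap_centroid K delta @` unit_sphere].
have img : bdry (eball c r) = cap_centroid K delta @` unit_sphere.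
  rewrite bdry_eball//; apply/seteqP; split => [x /= xr|_ [u /unit_sphereP u1 <-]].
    have u1 : unit_sphere (r^-1 *: (x - c)).
      by apply/unit_sphereP; rewrite dotZl dotZr xr; field; exact: lt0r_neq0.
    exists (r^-1 *: (x - c)) => //.
    by rewrite X// scalerA mulfV ?gt_eqF// scale1r addrC subrK.
  have uS : unit_sphere u by exact/unit_sphereP.
  by rewrite /= X// addrC addKr dotZl dotZr u1 mulr1.
have [bM MB] : P (metronoid K delta).
  by apply: (@getPex _ P); exists (eball c r); split => //; exact: convex_body_eball.
by apply: bdry_eball_inj => //; rewrite MB img.
Qed.

(* When no convex body has the prescribed boundary, [metronoid] is the junk
   value of [get], which is a constant predicate and hence no ball. *)
Lemma bdry_metronoid_ball c r : 0 < r -> metronoid K delta = eball c r ->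
  bdry (eball c r) = cap_centroid K delta @` unit_sphere.
Proof.
move=> r0 Mball; pose P := [set M | convex_body M /\ bdry M = cap_centroid K delta @` unit_sphere].
have [[M PM]|noP] := pselect (exists M, P M).
  have [_] : P (metronoid K delta) by apply: (@getPex _ P); exists M.
  by rewrite Mball.
have Mpt : metronoid K delta = point by apply: xgetPN => M PM; apply: noP; exists M.
pose e : 'rV[R]_n.+1 := delta_mx 0 0.
have ee : dot e e = 1 by rewrite dot_delta mxE !eqxx.
have r0' := ltW r0.
have cB : eball c r c by apply/eballP => //; rewrite subrr dot0l sqr_ge0.
have : eball c r (c + (r + 1) *: e) by rewrite -Mball Mpt; move: cB; rewrite -Mball Mpt.
move=> /(eballP _ _ r0'); rewrite addrC addKr dotZl dotZr ee => h; exfalso; move: h; nra.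
Qed.

Context (hK : convex_body K) (d0 : 0 < delta) (d1 : delta < 1).

(** The point [c + r u] is some centroid, so extremality gives [<X(u) - c, u> >= r] while
    [|X(u) - c| = r]. This is the equality case of Cauchy-Schwarz: the squared norm of
    [X(u) - c - r u] is at most zero. *)
Lemma cap_centroid_ball c r u : 0 < r ->
  bdry (eball c r) = cap_centroid K delta @` unit_sphere ->
  unit_sphere u -> cap_centroid K delta u = c + r *: u.
Proof.
move=> r0 img u1; have uu := (unit_sphereP u).1 u1; rewrite bdry_eball// in img.
have Xr : dot (cap_centroid K delta u - c) (cap_centroid K delta u - c) = r ^+ 2.
  have : (cap_centroid K delta @` unit_sphere) (cap_centroid K delta u) by exists u.
  by rewrite -img.
have [w w1 wE] : (cap_centroid K delta @` unit_sphere) (c + r *: u).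
  by rewrite -img /= addrC addKr dotZl dotZr uu mulr1.
have := cap_centroid_extremal hK d0 d1 u1 w1; rewrite wE dotDl dotZl uu mulr1 => ext.
apply/eqP; rewrite -subr_eq0 opprD addrA; apply/eqP/dot_eq0.
have h : r <= dot (cap_centroid K delta u - c) u by rewrite dotBl; lra.
move: (cap_centroid K delta u - c) h Xr => X h Xr.
rewrite dotBl !dotBr !dotZl !dotZr uu Xr (dotC u X); nra.
Qed.

(** The derivative of [<X(u), v>] towards [v] is twice the normalized moment by the general formula
    and [2 r] by the explicit one; a single sequence suffices to compare them. *)
Lemma section_moment_ball c r u v :
  (forall w, unit_sphere w -> cap_centroid K delta w = c + r *: w) ->
  unit_sphere u -> unit_sphere v -> dot v u = 0 ->
  section_moment K delta u v = delta * vol K * r.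
Proof.
move=> X u1 v1 vu.
have vv := (unit_sphereP v).1 v1.
have v0 := (convex_body_vol hK).2.
(* Starting at one half keeps every term strictly below 1. *)
pose h_ (k : nat) : R := k.+2%:R^-1.
have h01 k : 0 < h_ k < 1.
  by rewrite /h_ invr_gt0 ltr0n/= invf_lt1 ?ltr0n// ltr1n.
have hcvg : h_ @ \oo --> (0 : R).
  by have := @cvg_harmonic R; rewrite -cvg_shiftS.
have D := cap_centroid_derivative hK d0 d1 u1 v1 vu h01 hcvg (e := v).
have D' : (fun k => r * (2 / (1 + h_ k * h_ k))) @ \oo --> r * 2.
  suff : (fun k => r * (2 / (1 + h_ k * h_ k))) @ \oo --> r * (2 / (1 + 0 * 0)).
    by rewrite mul0r addr0 divr1.
  apply: cvgMl_tmp; apply: cvgMl_tmp; apply: cvgV; first by rewrite mul0r addr0.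
  by apply: cvgD; [exact: cvg_cst|exact: cvgM].
have E : (delta * vol K)^-1 * section_cov K u (cut_level K delta u) v v * 2 = r * 2.
  apply: (cvg_unique _ D); first exact: norm_hausdorff.
  apply: cvg_trans D'; apply: near_eq_cvg; apply: nearW => k.
  rewrite !X//; last exact: unit_rotate.
  rewrite /rotate !dotDl !dotZl dotDl !dotZl vv (dotC u v) vu.
  have h0 : h_ k != 0 by have /andP[? _] := h01 k; rewrite gt_eqF.
  by field; rewrite h0 onepsq_neq0.
rewrite section_moment_cov//.
have v0' : delta * vol K != 0 by rewrite mulf_neq0// gt_eqF.
by apply: (mulfI (invr_neq0 v0')); rewrite [RHS]mulKf//; lra.
Qed.

End metronoids.

Theorem theorem1p1 (R : realType) (n : nat) (delta : R) (K : set 'rV[R]_n)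
    (hn : (2 <= n)%N) (hdelta0 : 0 < delta) (hdelta2 : delta <= 2^-1)
    (hK : convex_body K)
    (hKdelta : C1_body (floating_body K delta) \/
      exists p, floating_body K delta = [set p] /\
                is_dupin_floating_body K delta [set p]) :
  (ulam_floating_body K delta <->
     exists r : R, 0 < r /\
       forall u v : 'rV[R]_n, unit_sphere u -> unit_sphere v -> dot v u = 0 ->
         section_moment K delta u v = delta * vol K * r) /\
  (forall r : R, 0 < r ->
     (forall u v : 'rV[R]_n, unit_sphere u -> unit_sphere v -> dot v u = 0 ->
        section_moment K delta u v = delta * vol K * r) ->
     exists c : 'rV[R]_n, metronoid K delta = eball c r).
Proof.
have d1 : delta < 1 by lra.
case: n K hn hK hKdelta => [//|n] K hn hK _.
have ball r : 0 < r ->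
    (forall u v : 'rV[R]_n.+1, unit_sphere u -> unit_sphere v -> dot v u = 0 ->
       section_moment K delta u v = delta * vol K * r) ->
    exists c : 'rV[R]_n.+1, metronoid K delta = eball c r.
  move=> r0 moment; pose e : 'rV[R]_n.+1 := delta_mx 0 0.
  have e1 : unit_sphere e by apply/unit_sphereP; rewrite dot_delta mxE !eqxx.
  (* The centre is the common value of [X(u) - r u], read off at an arbitrary unit vector. With the
     dimension written [n.+1], [hn] is the condition [0 < n] of [isotropic_centroid]. *)
  exists (cap_centroid K delta e - r *: e); apply: metronoid_ball => // u u1.
  by rewrite -(isotropic_centroid hK hdelta0 d1 moment hn e1 u1) subrK.
split=> //; split => [[c [r [r0 Mball]]]|[r [r0 moment]]].
  exists r; split => // u v; apply: (section_moment_ball hK hdelta0 d1 (c := c)) => w w1.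
  exact: cap_centroid_ball (bdry_metronoid_ball r0 Mball) w1.
by have [c cE] := ball r r0 moment; exists c, r.
Qed.
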